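(* Let $A\subseteq\omega$ be a c.e. infinite set and for $f,g\in\widehat{\mathcal S}^{(1)}_A$ set $f\sqsubseteq g$ iff $\mathrm{graph}(f)\subseteq\mathrm{graph}(g)$. Then $(\widehat{\mathcal S}^{(1)}_A,\sqsubseteq)$ is an effectively given algebraic domain (with basis $\mathrm{Anf}^{(1)}_A$ numbered by $\alpha^{(1)}$) such that: (1) The nowhere defined function is the least element. (2) The initial segment functions in $\mathrm{Anf}^{(1)}_A$ are exactly the compact elements. (3) The functions in $\mathcal S^{(1)}_A$ are exactly the computable elements. (4) For numberings of $\mathcal S^{(1)}_A$, conditions (QGN I) and (A I) are equivalent, and conditions (QGN II) and (A II) are equivalent. In particular, the quasi-Gödel numberings of $\mathcal S^{(1)}_A$ are exactly the admissible numberings. (5) For operators $G:\widehat{\mathcal S}^{(1)}_A\to\widehat{\mathcal S}^{(1)}_A$, $G$ is computable as an operator (enumeration sense) if and only if $G$ is computable as a map between effectively given domains.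
   Context: $\omega$ is the set of natural numbers; $\mathcal F^{(1)}$ is the set of all functions $\omega\to\omega$, $\mathcal R^{(n)}$ the set of total computable functions $\omega^n\to\omega$. $\langle\cdot,\cdot\rangle:\omega^2\to\omega$ is a computable bijection with $\langle x,y\rangle\ge x,y$. $W_i=\mathrm{dom}(\varphi_i)$ for a fixed Gödel numbering $\varphi$ of the unary partial computable functions. $\mathrm{Anf}^{(1)}_A$ is the set of partial functions from $\omega$ to $\omega$ whose domain is either empty or equal to $\{0,\dots,a-1\}$ for some $a\in A$; $\mathcal S^{(1)}_A=\mathcal R^{(1)}\cup\mathrm{Anf}^{(1)}_A$ and $\widehat{\mathcal S}^{(1)}_A=\mathcal F^{(1)}\cup\mathrm{Anf}^{(1)}_A$. $\mathrm{graph}(q)=\{\langle x,q(x)\rangle:x\in\mathrm{dom}(q)\}$. The extended graph of a unary partial function $q$ is $\{\langle y,0\rangle:y\in\omega\}\cup\{\langle x,q(x)+1\rangle:x\in\mathrm{dom}(q)\}$, and that of a binary one is $\{\langle\langle y,y'\rangle,0\rangle:y,y'\in\omega\}\cup\{\langle\langle x,x'\rangle,q(x,x')+1\rangle:(x,x')\in\mathrm{dom}(q)\}$. A numbering of a set $X$ is a surjection $\omega\to X$. For a numbering $\theta$ of $\mathcal S^{(1)}_A$: (QGN I) the extended graph of $(i,x)\mapsto\theta_i(x)$ is the range of a function in $\mathcal R^{(1)}$; (QGN II) for every $k\in\mathcal R^{(2)}$ there is $v\in\mathcal R^{(1)}$ such that for all $i\in\omega$, $r\in\mathcal S^{(1)}_A$: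 if $\{k(i,t):t\in\omega\}$ is the extended graph of $r$, then $r=\theta_{v(i)}$. $\theta$ is a quasi-Gödel numbering if both hold. Canonical numbering $\alpha^{(1)}$ of $\mathrm{Anf}^{(1)}_A$: let $f_A\in\mathcal R^{(1)}$ have range $A$ and fix an effective bijective coding of finite sequences of natural numbers by natural numbers, with length $\mathrm{lth}(a)$ and entries $(a)_j$, $1\le j\le\mathrm{lth}(a)$. Put $\widehat\alpha_{\langle a,b\rangle}(x)=(a)_{x+1}$ if $x<\min\{\mathrm{lth}(a),f_A(b)\}$; $=0$ if $\mathrm{lth}(a)\le x<f_A(b)$; undefined otherwise. $\alpha^{(1)}_0$ is the nowhere defined function and $\alpha^{(1)}_{i+1}=\widehat\alpha_j$ for the least $j$ with $\widehat\alpha_j\notin\{\alpha^{(1)}_0,\dots,\alpha^{(1)}_i\}$. Domain theory: in a poset $(D,\sqsubseteq)$, a directed set is a non-empty subset in which every two elements have an upper bound in the subset. $x\ll y$ means: for every directed $L\subseteq D$ with existing least upper bound, $y\sqsubseteq\bigsqcup L$ implies $x\sqsubseteq u$ for some $u\in L$. $x$ is compact if $x\ll x$. $B\subseteq D$ is a basis if for each $x\in D$ the set $B_x=\{u\in B:u\ll x\}$ contains a directed subset with least upper bound $x$. A domain is a poset with least element $\bot$ in which all directed sets have least upper bounds and which has a basis; it is algebraic if its compact elements form a basis. A domain $D$ with countable basis $B$ and numbering $\beta:\omega\to B$ is effectively given if $\{\langle i,j\rangle:\beta_i\ll\beta_j\}$ is c.e. Then $x\in D$ is computable if $\{i:\beta_i\ll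 x\}$ is c.e.; $D_c$ is the set of computable elements. A map $G:D\to D'$ between effectively given domains (numbered bases $\beta,\beta'$) is computable if it is Scott-continuous (monotone and preserving existing least upper bounds of directed sets) and $\{\langle i,j\rangle:\beta'_j\ll G(\beta_i)\}$ is c.e. A numbering $\eta$ of $D_c$ is admissible if (A I) $\{\langle i,j\rangle:\beta_i\ll\eta_j\}$ is c.e., and (A II) there is $d\in\mathcal R^{(1)}$ such that for all $i$, if $\beta[W_i]$ is directed then $\eta_{d(i)}=\bigsqcup\beta[W_i]$. Operator computability (enumeration sense): $G:\widehat{\mathcal S}^{(1)}_A\to\widehat{\mathcal S}^{(1)}_A$ is computable if there is a c.e. set $C\subseteq\omega$ such that for all $r\in\widehat{\mathcal S}^{(1)}_A$, $\mathrm{graph}(G(r))$ is the set of all $\langle y,z\rangle$ for which there is $a$ with $\langle\langle y,z\rangle,a\rangle\in C$ such that every entry of the sequence coded by $a$ belongs to $\mathrm{graph}(r)$. *)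

(* Defs.v *)
From mathcomp Require Import all_boot.
From mathcomp Require Import boolp classical_sets functions cardinality.

Set Implicit Arguments.
Unset Strict Implicit.
Unset Printing Implicit Defensive.

Local Open Scope classical_set_scope.

(* Partial functions are [option]-valued, so that (with functional
   extensionality) Leibniz equality is equality of partial functions. *)
Definition pfn (n : nat) := n.-tuple nat -> option nat.

Definition pfn_comp n m (f : pfn m) (g : 'I_m -> pfn n) : pfn n :=
  fun t => if [forall i, isSome (g i t)]
           then f [tuple odflt 0 (g i t) | i < m] else None.

Fixpoint pfn_rec n (f : pfn n) (g : pfn n.+2) (y : nat) (t : n.-tuple nat) :
    option nat :=
  match y with
  | 0 => f t
  | y'.+1 => obind (fun z => g [tuple of y' :: z :: t]) (pfn_rec f g y' t)
  end.

(* [h t] is the least [y] with [f (y, t) = 0] such that [f (z, t)] is defined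
   (and nonzero) for all [z < y], and is undefined if there is no such [y]. *)
Definition is_minimization n (f : pfn n.+1) (h : pfn n) : Prop :=
  forall t y, h t = Some y <->
    f [tuple of y :: t] = Some 0 /\
    forall z, z < y -> exists v, f [tuple of z :: t] = Some v.+1.

Inductive mu_recursive : forall n, pfn n -> Prop :=
| mu_zero n : mu_recursive (fun _ : n.-tuple nat => Some 0)
| mu_succ : mu_recursive (fun t : 1.-tuple nat => Some (thead t).+1)
| mu_proj n (i : 'I_n) : mu_recursive (fun t : n.-tuple nat => Some (tnth t i))
| mu_comp n m (f : pfn m) (g : 'I_m -> pfn n) :
    mu_recursive f -> (forall i, mu_recursive (g i)) ->
    mu_recursive (pfn_comp f g)
| mu_rec n (f : pfn n) (g : pfn n.+2) :
    mu_recursive f -> mu_recursive g ->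
    mu_recursive
      (fun t : n.+1.-tuple nat => pfn_rec f g (thead t) [tuple of behead t])
| mu_min n (f : pfn n.+1) (h : pfn n) :
    mu_recursive f -> is_minimization f h -> mu_recursive h.

Definition pfun1 := nat -> option nat.
Definition pfun2 := nat -> nat -> option nat.

Definition pcomputable1 (q : pfun1) : Prop :=
  mu_recursive (fun t : 1.-tuple nat => q (thead t)).

Definition pcomputable2 (q : pfun2) : Prop :=
  mu_recursive (fun t : 2.-tuple nat => q (tnth t ord0) (tnth t ord_max)).

Definition R1 : set (nat -> nat) :=
  [set f | pcomputable1 (fun x => Some (f x))].

Definition R2 : set (nat -> nat -> nat) :=
  [set k | pcomputable2 (fun x y => Some (k x y))].

Definition dom (q : pfun1) : set nat := [set x | isSome (q x)].

Definition ce (X : set nat) : Prop := exists2 q, pcomputable1 q & X = dom q.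

(* A numbering of the unary partial computable functions with a computable
   universal function and the s-m-n property. *)
Definition goedel_numbering (phi : nat -> pfun1) : Prop :=
  [/\ range phi = [set q | pcomputable1 q],
      pcomputable2 phi
    & forall psi : pfun2, pcomputable2 psi ->
        exists2 s, R1 s & forall i, phi (s i) = psi i].

Definition W (phi : nat -> pfun1) (i : nat) : set nat := dom (phi i).

Record pairing := Pairing {
  pair_code :> nat * nat -> nat;
  pair_decode : nat -> nat * nat;
  pair_codeK : cancel pair_code pair_decode;
  pair_decodeK : cancel pair_decode pair_code;
  pair_computable : R2 (fun x y => pair_code (x, y));
  pair_ge : forall x y, x <= pair_code (x, y) /\ y <= pair_code (x, y) }.

(* [nth 0 (seq_decode a) x] is the entry (a)_{x+1}; out of range it is 0. *)
Record seq_coding := SeqCoding {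
  seq_code : seq nat -> nat;
  seq_decode : nat -> seq nat;
  seq_codeK : cancel seq_code seq_decode;
  seq_decodeK : cancel seq_decode seq_code;
  lth_computable : R1 (fun a => size (seq_decode a));
  entry_computable : R2 (fun a x => nth 0 (seq_decode a) x) }.

Definition pair_set (P : pairing) (r : nat -> nat -> Prop) : set nat :=
  [set P ij | ij in [set ij | r ij.1 ij.2]].

Definition graph (P : pairing) (q : pfun1) : set nat :=
  pair_set P (fun x y => q x = Some y).

Definition ext_graph1 (P : pairing) (q : pfun1) : set nat :=
  [set P (y, 0) | y in setT] `|`
  [set n | exists x v, q x = Some v /\ n = P (x, v.+1)].

Definition ext_graph2 (P : pairing) (q : pfun2) : set nat :=
  [set P (P y, 0) | y in setT] `|`
  [set n | exists x x' v, q x x' = Some v /\ n = P (P (x, x'), v.+1)].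

Definition total (f : nat -> nat) : pfun1 := fun x => Some (f x).

Definition nowhere : pfun1 := fun=> None.

Definition Anf (A : set nat) : set pfun1 :=
  [set q | dom q = set0 \/ exists2 a, A a & dom q = `I_a].

Definition S1 (A : set nat) : set pfun1 := total @` R1 `|` Anf A.

Definition S1hat (A : set nat) : set pfun1 := range total `|` Anf A.

Definition least (X : set nat) : nat :=
  xget 0 [set j | X j /\ forall k, X k -> j <= k].

Definition alpha_hat (P : pairing) (c : seq_coding) (fA : nat -> nat) (n : nat) :
    pfun1 :=
  let: (a, b) := pair_decode P n in
  fun x =>
    if x < minn (size (seq_decode c a)) (fA b) then Some (nth 0 (seq_decode c a) x)
    else if x < fA b then Some 0
    else None.

(* The list of the first [n.+1] values of the canonical numbering. *)
Fixpoint alpha_upto (P : pairing) (c : seq_coding) (fA : nat -> nat) (n : nat) :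
    seq pfun1 :=
  match n with
  | 0 => [:: nowhere]
  | i.+1 =>
      let s := alpha_upto P c fA i in
      rcons s (alpha_hat P c fA (least [set j | alpha_hat P c fA j \notin s]))
  end.

Definition alpha (P : pairing) (c : seq_coding) (fA : nat -> nat) (n : nat) :
    pfun1 :=
  last nowhere (alpha_upto P c fA n).

Definition QGN1 (P : pairing) (theta : nat -> pfun1) : Prop :=
  exists2 h, R1 h & range h = ext_graph2 P theta.

Definition QGN2 (P : pairing) (A : set nat) (theta : nat -> pfun1) : Prop :=
  forall k, R2 k -> exists2 v, R1 v &
    forall i r, S1 A r -> range (k i) = ext_graph1 P r -> r = theta (v i).

Definition quasi_goedel (P : pairing) (A : set nat) (theta : nat -> pfun1) :
    Prop :=
  [/\ range theta = S1 A, QGN1 P theta & QGN2 P A theta].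

Section DomainTheory.
Context {T : Type} (D : set T) (le : T -> T -> Prop).

Definition partial_order : Prop :=
  [/\ forall x, D x -> le x x,
      forall x y, D x -> D y -> le x y -> le y x -> x = y
    & forall x y z, D x -> D y -> D z -> le x y -> le y z -> le x z].

Definition is_least (x : T) : Prop := D x /\ forall y, D y -> le x y.

Definition is_lub (L : set T) (s : T) : Prop :=
  [/\ D s, forall u, L u -> le u s
    & forall v, D v -> (forall u, L u -> le u v) -> le s v].

Definition directed (L : set T) : Prop :=
  [/\ L `<=` D, L !=set0
    & forall u v, L u -> L v -> exists w, [/\ L w, le u w & le v w]].

Definition way_below (x y : T) : Prop :=
  forall L s, directed L -> is_lub L s -> le y s -> exists2 u, L u & le x u.

Definition compact_elements : set T := [set x | D x /\ way_below x x].

Definition is_basis (B : set T) : Prop :=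
  B `<=` D /\
  forall x, D x -> exists L, [/\ L `<=` [set u | B u /\ way_below u x],
                                 directed L & is_lub L x].

Definition is_domain : Prop :=
  [/\ partial_order, exists bot, is_least bot,
      forall L, directed L -> exists s, is_lub L s
    & exists B, is_basis B].

Definition is_algebraic_domain : Prop :=
  is_domain /\ is_basis compact_elements.

Variables (P : pairing) (beta : nat -> T).

Definition effectively_given (B : set T) : Prop :=
  [/\ is_domain, is_basis B, range beta = B
    & ce (pair_set P (fun i j => way_below (beta i) (beta j)))].

Definition computable_elements : set T :=
  [set x | D x /\ ce [set i | way_below (beta i) x]].

Definition A1 (eta : nat -> T) : Prop :=
  ce (pair_set P (fun i j => way_below (beta i) (eta j))).

Definition A2 (phi : nat -> pfun1) (eta : nat -> T) : Prop :=
  exists2 d, R1 d &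
    forall i, directed (beta @` W phi i) -> is_lub (beta @` W phi i) (eta (d i)).

Definition admissible (phi : nat -> pfun1) (eta : nat -> T) : Prop :=
  [/\ range eta = computable_elements, A1 eta & A2 phi eta].

End DomainTheory.

Definition scott_continuous {T T' : Type} (D : set T) (le : T -> T -> Prop)
    (D' : set T') (le' : T' -> T' -> Prop) (G : T -> T') : Prop :=
  (forall x y, D x -> D y -> le x y -> le' (G x) (G y)) /\
  (forall L s, directed D le L -> is_lub D le L s ->
     is_lub D' le' (G @` L) (G s)).

Definition computable_map {T T' : Type} (P : pairing)
    (D : set T) (le : T -> T -> Prop) (beta : nat -> T)
    (D' : set T') (le' : T' -> T' -> Prop) (beta' : nat -> T')
    (G : T -> T') : Prop :=
  scott_continuous D le D' le' G /\
  ce (pair_set P (fun i j => way_below D' le' (beta' j) (G (beta i)))).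

Definition sub_graph (P : pairing) (f g : pfun1) : Prop :=
  graph P f `<=` graph P g.

Definition computable_operator (P : pairing) (c : seq_coding) (A : set nat)
    (G : pfun1 -> pfun1) : Prop :=
  exists2 C, ce C & forall r, S1hat A r ->
    graph P (G r) =
    pair_set P (fun y z => exists2 a, C (P (P (y, z), a)) &
                  forall n, n \in seq_decode c a -> graph P r n).

(* Main.v *)
(* Two ideas carry the proof. First, the graph of every mu-recursive function
   is the projection of a decidable relation (Kleene), so the c.e. relations
   are closed under conjunction, disjunction, existential quantification and
   bounded universal quantification, and every effectivity claim reduces to
   writing a relation with these connectives. Second, in the domain the
   supremum of a directed set is the union of its members, so that an initial
   segment function is way below q exactly when it is a restriction of q, and
   q is the directed union of its restrictions in Anf. Hence a numbering theta
   satisfies (QGN I) or (A I) iff its universal function has a c.e. graph, and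
   (QGN II) and (A II) translate into each other by passing from an enumeration
   of an extended graph to an enumeration of the initial segments below it and
   back. *)

Require Import Defs.
From mathcomp Require Import all_boot.
From mathcomp Require Import boolp classical_sets functions cardinality.

Local Open Scope classical_set_scope.

Set Implicit Arguments.
Unset Strict Implicit.
Unset Printing Implicit Defensive.

(** * Total recursive functions *)

Definition mu_total n (f : n.-tuple nat -> nat) : Prop :=
  mu_recursive (fun t => Some (f t)).

Lemma mu_total_eq n (f g : n.-tuple nat -> nat) :
  f =1 g -> mu_total f -> mu_total g.
Proof. by move=> /funext ->. Qed.

Lemma mu_recursive_comp n m (f : pfn m) (g : 'I_m -> n.-tuple nat -> nat) :
  mu_recursive f -> (forall i, mu_total (g i)) ->
  mu_recursive (fun t => f [tuple g i t | i < m]).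
Proof.
move=> mf mg; have := mu_comp mf mg; congr mu_recursive.
apply: funext => t; rewrite /pfn_comp.
have -> : [forall i : 'I_m, isSome (Some (g i t))] by apply/forallP.
by congr f; apply: eq_from_tnth => i; rewrite !tnth_mktuple.
Qed.

Lemma mu_recursive_comp1 n (q : pfun1) (u : n.-tuple nat -> nat) :
  pcomputable1 q -> mu_total u -> mu_recursive (fun t => q (u t)).
Proof.
move=> mq mu; have := mu_recursive_comp (g := fun _ => u) mq (fun=> mu).
congr mu_recursive; apply: funext => t; congr q.
by rewrite /thead tnth_mktuple.
Qed.

Lemma mu_recursive_comp2 n (q : pfun2) (u v : n.-tuple nat -> nat) :
  pcomputable2 q -> mu_total u -> mu_total v ->
  mu_recursive (fun t => q (u t) (v t)).
Proof.
move=> mq mu mv.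
have mg (i : 'I_2) : mu_total (if i == ord0 then u else v) by case: ifP.
have := mu_recursive_comp mq mg; congr mu_recursive.
by apply: funext => t; rewrite !tnth_mktuple.
Qed.

Lemma mu_total_R1 n f (u : n.-tuple nat -> nat) :
  R1 f -> mu_total u -> mu_total (fun t => f (u t)).
Proof. exact: mu_recursive_comp1. Qed.

Lemma mu_total_R2 n k (u v : n.-tuple nat -> nat) :
  R2 k -> mu_total u -> mu_total v -> mu_total (fun t => k (u t) (v t)).
Proof. exact: mu_recursive_comp2. Qed.

Lemma mu_total_proj n (i : 'I_n) : mu_total (fun t => tnth t i).
Proof. exact: mu_proj. Qed.

Lemma R1_comp f g : R1 f -> R1 g -> R1 (fun x => f (g x)).
Proof. exact: mu_total_R1. Qed.

Lemma R1_R2 k f g : R2 k -> R1 f -> R1 g -> R1 (fun x => k (f x) (g x)).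
Proof. exact: mu_total_R2. Qed.

Lemma R1_id : R1 id.
Proof. exact: mu_proj. Qed.

Lemma R1_succ : R1 succn.
Proof. exact: mu_succ. Qed.

Lemma mu_total_cst n k : mu_total (fun _ : n.-tuple nat => k).
Proof.
elim: k => [|k IH]; first exact: mu_zero.
exact: mu_total_R1 R1_succ IH.
Qed.

Lemma mu_total_nth n i : mu_total (fun t : n.-tuple nat => nth 0 t i).
Proof.
have [lt_in|le_ni] := ltnP i n.
  by apply: (mu_total_eq _ (mu_total_proj (Ordinal lt_in))) => t;
    rewrite (tnth_nth 0).
by apply: (mu_total_eq _ (mu_total_cst n 0)) => t;
  rewrite nth_default ?size_tuple.
Qed.

Lemma mu_total_rec n (f : n.-tuple nat -> nat) (g : n.+2.-tuple nat -> nat) :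
  mu_total f -> mu_total g ->
  mu_total (fun t : n.+1.-tuple nat =>
    nat_rect (fun=> nat) (f [tuple of behead t])
      (fun y z => g [tuple of y :: z :: [tuple of behead t]]) (thead t)).
Proof.
move=> mf mg; have := mu_rec mf mg; congr mu_recursive.
by apply: funext => t; elim: (thead t) => //= y ->.
Qed.

Lemma R2_rec a s : R1 a -> mu_total (fun t : 3.-tuple nat =>
    s (nth 0 t 0) (nth 0 t 1) (nth 0 t 2)) ->
  R2 (fun y x => nat_rect (fun=> nat) (a x) (fun y z => s y z x) y).
Proof.
move=> ma ms.
have ma' : mu_total (fun t : 1.-tuple nat => a (tnth t ord0)) by [].
apply: (mu_total_eq _ (mu_total_rec ma' ms)) => t.
case/tupleP: t => y t; case/tupleP: t => x t.
by rewrite /thead !(tnth_nth 0).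
Qed.

Lemma R2_swap k : R2 k -> R2 (fun x y => k y x).
Proof. by move=> mk; apply: mu_total_R2 mk _ _; exact: mu_total_proj. Qed.

Lemma R1_pred : R1 predn.
Proof.
have : R2 (fun y x => nat_rect (fun=> nat) 0 (fun y z => y) y).
  by apply: (R2_rec (s := fun y z x => y) (mu_total_cst _ 0));
    exact: mu_total_nth.
move/R1_R2 => /(_ id id R1_id R1_id).
by congr R1; apply: funext => -[].
Qed.

Lemma R2_add : R2 addn.
Proof.
have : R2 (fun y x => nat_rect (fun=> nat) x (fun y z => z.+1) y).
  apply: (R2_rec (s := fun y z x => z.+1) R1_id).
  exact: mu_total_R1 R1_succ (mu_total_nth _ _).
congr R2; apply: funext => y; apply: funext => x.
by elim: y => //= y ->.
Qed.

Lemma R2_sub : R2 subn.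
Proof.
suff : R2 (fun y x => nat_rect (fun=> nat) x (fun y z => z.-1) y).
  move/R2_swap; congr R2; apply: funext => x; apply: funext.
  by elim=> [|y IH] /=; rewrite ?subn0 // subnS IH.
apply: (R2_rec (s := fun y z x => z.-1) R1_id).
exact: mu_total_R1 R1_pred (mu_total_nth _ _).
Qed.

(** * Unbounded search *)

Definition search (d : nat -> bool) : option nat :=
  if pselect (exists y, d y) is left e then Some (ex_minn e) else None.

Lemma searchP d y :
  search d = Some y <-> d y /\ forall z, z < y -> ~~ d z.
Proof.
rewrite /search; case: pselect => [e|nd]; last first.
  by split=> // -[dy _]; case: nd; exists y.
case: ex_minnP => m dm mmin; split=> [[<-]|[dy ymin]].
  by split=> // z; apply: contraTN => /mmin; rewrite -leqNgt.
congr Some; apply/eqP; rewrite eqn_leq mmin //= leqNgt.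
by apply/negP => /ymin; rewrite dm.
Qed.

Lemma search_some d : isSome (search d) <-> exists y, d y.
Proof. by rewrite /search; case: pselect. Qed.

(** Minimization looks for a zero, and [~~ d] read as a number is 0 exactly where [d] holds. Because
    it is total, the requirement of definedness below the zero is automatic. *)
Lemma mu_search n (d : n.-tuple nat -> nat -> bool) :
  mu_total (fun t : n.+1.-tuple nat =>
    ~~ d [tuple of behead t] (thead t) : nat) ->
  mu_recursive (fun t => search (d t)).
Proof.
move=> md; apply: mu_min md _ => t y; rewrite searchP theadE.
have bE z : [tuple of behead [tuple of z :: t]] = t by exact: val_inj.
rewrite bE; split=> -[dy ymin]; split.
- by rewrite dy.
- by move=> z /ymin dz; exists 0; rewrite theadE bE dz.
- by case: dy; case: (d t y).
- by move=> z /ymin[v]; rewrite theadE bE; case: (d t z).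
Qed.
Lemma R2_eqn : R2 (fun x y => (x == y : nat)).
Proof.
have : R2 (fun x y => 1 - ((x - y) + (y - x))).
  have m1 := mu_total_R2 R2_sub (mu_total_proj (ord0 : 'I_2))
    (mu_total_proj ord_max).
  have m2 := mu_total_R2 R2_sub (mu_total_proj (ord_max : 'I_2))
    (mu_total_proj ord0).
  exact: mu_total_R2 R2_sub (mu_total_cst _ 1) (mu_total_R2 R2_add m1 m2).
congr R2; apply: funext => x; apply: funext => y.
by rewrite eqn_leq -!subn_eq0; case: (x - y) (y - x) => [|m] [|n].
Qed.

Lemma R1_least (d : nat -> nat -> bool) :
  R2 (fun x y => d x y : nat) -> (forall x, exists y, d x y) ->
  exists2 m, R1 m & forall x, search (d x) = Some (m x).
Proof.
move=> md ex.
have someE x : search (d x) = Some (odflt 0 (search (d x))).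
  by have /search_some := ex x; case: search.
exists (fun x => odflt 0 (search (d x))) => //.
have := @mu_search 1 (fun t => d (thead t)); rewrite /R1 /=.
have E : (fun t : 1.-tuple nat => search (d (thead t))) =
         (fun t : 1.-tuple nat => Some (odflt 0 (search (d (thead t))))).
  by apply: funext => t.
rewrite E; apply.
have m1 := mu_total_R2 md (mu_total_nth 2 1) (mu_total_nth 2 0).
apply: (mu_total_eq _ (mu_total_R2 R2_sub (mu_total_cst _ 1) m1)) => t.
case/tupleP: t => y t; case/tupleP: t => x t.
by rewrite /thead !(tnth_nth 0) /=; case: (d x y).
Qed.

(** * Computability on products of copies of the natural numbers *)

(** The coding is a bijection with the natural numbers, so computability on [X] is plain transport
    of [R1], with no side condition on which numbers are codes. *)
Class enc (X : Type) := Enc {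
  code : X -> nat;
  decode : nat -> X;
  codeK : cancel code decode;
  decodeK : cancel decode code }.

#[global] Instance enc_nat : enc nat :=
  @Enc nat id id (fun=> erefl) (fun=> erefl).

Section Computability.
Variables (P : pairing) (c : seq_coding).

#[export] Instance enc_prod X Y (eX : enc X) (eY : enc Y) : enc (X * Y).
Proof.
refine (@Enc _ (fun p => P (code p.1, code p.2))
  (fun n => (decode (pair_decode P n).1, decode (pair_decode P n).2)) _ _).
- by move=> [x y]; rewrite pair_codeK /= !codeK.
- by move=> n /=; rewrite !decodeK -surjective_pairing pair_decodeK.
Defined.

(** Only the pairing itself is assumed computable, so its inverse is obtained by search. The search
    runs over codes of sequences, whose first two entries are already computable, until these
    entries pair to [e]. *)
Lemma R1_unpair :
  R1 (fun e => (pair_decode P e).1) /\ R1 (fun e => (pair_decode P e).2).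
Proof.
pose ent i a := nth 0 (seq_decode c a) i.
have ment n i j : mu_total (fun t : n.-tuple nat => ent i (nth 0 t j)).
  apply: mu_total_R2 (entry_computable c) (mu_total_nth _ _) (mu_total_cst _ _).
have [||m mm mE] := @R1_least (fun e a => P (ent 0 a, ent 1 a) == e).
- have : mu_total (fun t : 2.-tuple nat =>
      (P (ent 0 (nth 0 t 1), ent 1 (nth 0 t 1)) == nth 0 t 0 : nat)).
    apply: mu_total_R2 R2_eqn _ (mu_total_nth _ _).
    exact: mu_total_R2 (pair_computable P) (ment _ _ _) (ment _ _ _).
  by apply: mu_total_eq => t; rewrite !(tnth_nth 0).
- move=> e; exists (seq_code c [:: (pair_decode P e).1; (pair_decode P e).2]).
  by rewrite /ent seq_codeK /= -surjective_pairing pair_decodeK.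
have {}mE e : pair_decode P e = (ent 0 (m e), ent 1 (m e)).
  by have /searchP[/eqP E _] := mE e; rewrite -{1}E pair_codeK.
have ment' i : R1 (fun e => ent i (m e)).
  exact: mu_total_R2 (entry_computable c) (mu_total_R1 mm (mu_total_proj _))
    (mu_total_cst _ _).
by split; [have := ment' 0|have := ment' 1]; congr R1; apply: funext => e;
  rewrite mE.
Qed.

Section Comp.
Context {X : Type} {eX : enc X}.

Definition comp {Y} {eY : enc Y} (f : X -> Y) : Prop :=
  R1 (fun n => code (f (decode n))).

Lemma comp_id : comp (fun x => x).
Proof.
by have := R1_id; congr R1; apply: funext => n; rewrite decodeK.
Qed.

Lemma comp_cst Y {eY : enc Y} (y : Y) : comp (fun=> y).
Proof. exact: (mu_total_cst 1). Qed.

Lemma comp_R1 f (u : X -> nat) : R1 f -> comp u -> comp (fun x => f (u x)).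
Proof. exact: R1_comp. Qed.

Lemma comp_R2 k (u v : X -> nat) :
  R2 k -> comp u -> comp v -> comp (fun x => k (u x) (v x)).
Proof. exact: R1_R2. Qed.

Lemma comp_pair Y Z {eY : enc Y} {eZ : enc Z} (u : X -> Y) (v : X -> Z) :
  comp u -> comp v -> comp (fun x => (u x, v x)).
Proof. exact: R1_R2 (pair_computable P). Qed.

Lemma comp_fst Y Z {eY : enc Y} {eZ : enc Z} (u : X -> Y * Z) :
  comp u -> comp (fun x => (u x).1).
Proof.
move=> /(R1_comp (proj1 R1_unpair)); congr R1; apply: funext => n.
by rewrite pair_codeK.
Qed.

Lemma comp_snd Y Z {eY : enc Y} {eZ : enc Z} (u : X -> Y * Z) :
  comp u -> comp (fun x => (u x).2).
Proof.
move=> /(R1_comp (proj2 R1_unpair)); congr R1; apply: funext => n.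
by rewrite pair_codeK.
Qed.

Lemma comp_succ (u : X -> nat) : comp u -> comp (fun x => (u x).+1).
Proof. exact: R1_comp R1_succ. Qed.

Lemma comp_sub (u v : X -> nat) : comp u -> comp v -> comp (fun x => u x - v x).
Proof. exact: R1_R2 R2_sub. Qed.

Lemma comp_unpair (u : X -> nat) :
  comp u -> comp (fun x => pair_decode P (u x)).
Proof.
by congr R1; apply: funext => n; rewrite -[LHS](pair_decodeK P)
  [X in P X]surjective_pairing.
Qed.

Lemma comp_paircode (u : X -> nat * nat) : comp u -> comp (fun x => P (u x)).
Proof. by congr R1; apply: funext => n /=; rewrite -surjective_pairing. Qed.

Lemma comp_entry (u v : X -> nat) :
  comp u -> comp v -> comp (fun x => nth 0 (seq_decode c (u x)) (v x)).
Proof. exact: R1_R2 (entry_computable c). Qed.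

Lemma comp_size (u : X -> nat) : comp u ->
  comp (fun x => size (seq_decode c (u x))).
Proof. exact: R1_comp (lth_computable c). Qed.

Lemma comp_eqn (u v : X -> nat) :
  comp u -> comp v -> comp (fun x => (u x == v x : nat)).
Proof. exact: R1_R2 R2_eqn. Qed.

Lemma comp_leq (u v : X -> nat) :
  comp u -> comp v -> comp (fun x => (u x <= v x : nat)).
Proof.
move=> cu cv.
by apply: (comp_eqn (u := fun x => u x - v x));
  [exact: comp_sub|exact: comp_cst].
Qed.

Lemma comp_neg (b : X -> bool) :
  comp (fun x => b x : nat) -> comp (fun x => ~~ b x : nat).
Proof.
move=> cb; have := comp_sub (comp_cst 1) cb; congr comp.
by apply: funext => x; case: (b x).
Qed.

End Comp.

Lemma comp_compose X Y Z {eX : enc X} {eY : enc Y} {eZ : enc Z}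
    (f : Y -> Z) (u : X -> Y) :
  comp f -> comp u -> comp (fun x => f (u x)).
Proof.
move=> cf cu; have := R1_comp cf cu; congr R1.
by apply: funext => n; rewrite codeK.
Qed.

(** The recursion is carried out on codes of elements of [Y]; decoding at each step undoes the
    preceding encoding. *)
Lemma comp_rec X Y {eX : enc X} {eY : enc Y} (a : X -> Y) (u : X -> nat)
    (s : X -> nat -> Y -> Y) :
  comp a -> comp u -> comp (fun p : nat * Y * X => s p.2 p.1.1 p.1.2) ->
  comp (fun x => nat_rect (fun=> Y) (a x) (s x) (u x)).
Proof.
move=> ca cu cs.
have /R1_R2 : R2 (fun y n => nat_rect (fun=> nat) (code (a (decode n)))
    (fun y z => code (s (decode n) y (decode z))) y).
  apply: (R2_rec (s := fun y z n => code (s (decode n) y (decode z))) ca).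
  have mP n (f g : n.-tuple nat -> nat) : mu_total f -> mu_total g ->
    mu_total (fun t => P (f t, g t)) by exact: mu_total_R2 (pair_computable P).
  have mn := @mu_total_nth 3.
  apply: (mu_total_eq _ (mu_total_R1 cs (mP _ _ _ (mP _ _ _ (mn 0) (mn 1))
    (mn 2)))).
  by move=> t /=; rewrite !pair_codeK.
move=> /(_ _ _ cu R1_id); congr R1; apply: funext => n.
by elim: (u _) => //= k ->; rewrite codeK.
Qed.

Lemma comp_uncurry (k : nat -> nat -> nat) :
  R2 k <-> comp (fun p : nat * nat => k p.1 p.2).
Proof.
split=> ck.
  by apply: comp_R2 ck _ _; [apply: comp_fst|apply: comp_snd]; apply: comp_id.
have := mu_total_R1 ck (mu_total_R2 (pair_computable P)
  (mu_total_proj (ord0 : 'I_2)) (mu_total_proj ord_max)).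
by congr mu_recursive; apply: funext => t; rewrite /= pair_codeK.
Qed.

(** A case distinction is a recursion of length [b x], hence of zero or one step. *)
Lemma comp_if X Y {eX : enc X} {eY : enc Y} (b : X -> bool) (u v : X -> Y) :
  comp (fun x => b x : nat) -> comp u -> comp v ->
  comp (fun x => if b x then u x else v x).
Proof.
move=> cb cu cv; have := comp_rec (s := fun x _ _ => u x) cv cb.
have E : (fun x => nat_rect (fun=> Y) (v x) (fun _ _ => u x) (b x)) =
         (fun x => if b x then u x else v x).
  by apply: funext => x; case: (b x).
rewrite E; apply.
exact: comp_compose cu (comp_snd comp_id).
Qed.

Lemma comp_and X {eX : enc X} (b b' : X -> bool) :
  comp (fun x => b x : nat) -> comp (fun x => b' x : nat) ->
  comp (fun x => b x && b' x : nat).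
Proof.
move=> cb cb'; have := comp_if cb cb' (comp_cst 0); congr comp.
by apply: funext => x; case: (b x).
Qed.

Lemma comp_all X {eX : enc X} (u : X -> nat) (d : X -> nat -> bool) :
  comp u -> comp (fun p : X * nat => d p.1 p.2 : nat) ->
  comp (fun x => all (d x) (iota 0 (u x)) : nat).
Proof.
move=> cu cd.
have := comp_rec (s := fun x n z => if d x n then z else 0) (comp_cst 1) cu.
have E : (fun x => nat_rect (fun=> nat) 1 (fun n z => if d x n then z else 0)
  (u x)) =
         (fun x => all (d x) (iota 0 (u x)) : nat).
  apply: funext => x; elim: (u x) => // n IH.
  have -> : iota 0 n.+1 = rcons
    (iota 0 n) n by rewrite -cats1 -[n.+1]addn1 iotaD.
  by rewrite all_rcons /= {}IH; case: (d x n).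
rewrite E; apply; apply: comp_if; last exact: comp_cst; last first.
  exact: comp_snd (comp_fst comp_id).
apply: comp_compose cd (comp_pair (comp_snd comp_id) _).
exact: comp_fst (comp_fst comp_id).
Qed.

Lemma comp_least X {eX : enc X} (d : X -> nat -> bool) :
  comp (fun p : X * nat => d p.1 p.2 : nat) -> (forall x, exists y, d x y) ->
  exists2 m : X -> nat, comp m & forall x, search (d x) = Some (m x).
Proof.
move=> cd ex.
have [||m mm mE] := @R1_least (fun n => d (decode n)).
- by apply/comp_uncurry; have := cd; congr R1; apply: funext.
- by move=> n.
exists (fun x => m (code x)) => [|x]; last by rewrite -mE codeK.
by have := mm; congr R1; apply: funext => n; rewrite decodeK.
Qed.

(** Decomposes the function by its head symbol. Facts about particular functions are taken from the
    context only, so they have to be introduced as hypotheses of the form [R1], [R2] or [comp]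
    beforehand. *)
Ltac computable := cbv beta; try assumption;
  lazymatch goal with
  | |- comp (fun x => x) => exact comp_id
  | |- comp (fun _ => ?k) => exact (comp_cst k)
  | |- comp (fun x => (@?u x).1) => apply (comp_fst (u := u)); computable
  | |- comp (fun x => (@?u x).2) => apply (comp_snd (u := u)); computable
  | |- comp (fun x => (@?u x, @?v x)) =>
      apply (comp_pair (u := u) (v := v)); computable
  | |- comp (fun x => (@?u x).+1) => apply (comp_succ (u := u)); computable
  | |- comp (fun x => @?u x - @?v x) =>
      apply (comp_sub (u := u) (v := v)); computable
  | |- comp (fun x => pair_decode P (@?u x)) =>
      apply (comp_unpair (u := u)); computable
  | |- comp (fun x => pair_code P (@?u x)) =>
      apply (comp_paircode (u := u)); computable
  | |- comp (fun x => nth 0 (seq_decode c (@?u x)) (@?v x)) =>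
      apply (comp_entry (u := u) (v := v)); computable
  | |- comp (fun x => size (seq_decode c (@?u x))) =>
      apply (comp_size (u := u)); computable
  | |- comp (fun x => nat_of_bool (@?u x == @?v x)) =>
      apply (comp_eqn (u := u) (v := v)); computable
  | |- comp (fun x => nat_of_bool (@?u x <= @?v x)) =>
      apply (comp_leq (u := u) (v := v)); computable
  | |- comp (fun x => nat_of_bool (~~ @?u x)) =>
      apply (comp_neg (b := u)); computable
  | |- comp (fun x => nat_of_bool (@?u x && @?v x)) =>
      apply (comp_and (b := u) (b' := v)); computable
  | |- comp (fun x => nat_of_bool (all (@?d x) (iota 0 (@?u x)))) =>
      apply (comp_all (u := u) (d := d)); computable
  | H : R1 ?f |- comp (fun x => ?f (@?u x)) =>
      apply (comp_R1 (u := u) H); computable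
  | H : R2 ?k |- comp (fun x => ?k (@?u x) (@?v x)) =>
      apply (comp_R2 (u := u) (v := v) H); computable
  | H : comp ?f |- comp (fun x => ?f (@?u x)) =>
      apply (comp_compose (u := u) H); computable
  | H : comp (fun y => nat_of_bool (?d y)) |- comp (fun x => nat_of_bool (?d
    (@?u x))) =>
      apply (comp_compose (u := u) H); computable
  | |- _ => idtac
  end.

(** * Semidecidable relations *)

Section Sig1.
Context {X : Type} {eX : enc X}.

(** Projections of decidable relations, over any coded type; over the natural numbers these are the
    c.e. sets, as [ceP] shows. *)
Definition sig1 (R : X -> Prop) : Prop :=
  exists2 d : X * nat -> bool, comp (fun p => d p : nat) &
    forall x, R x <-> exists w, d (x, w).

Lemma sig1_iff (R R' : X -> Prop) : (forall x, R x <-> R' x) -> sig1 R ->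
  sig1 R'.
Proof. by move=> RR' [d cd dE]; exists d => // x; rewrite -RR'. Qed.

Lemma sig1_dec (b : X -> bool) : comp (fun x => b x : nat) ->
  sig1 (fun x => b x).
Proof.
move=> cb; exists (fun p => b p.1); first by apply: (comp_compose (u :=
  fun p => p.1) cb); computable.
by move=> x; split=> [bx|[]//]; exists 0.
Qed.

Lemma sig1_eq (u v : X -> nat) : comp u -> comp v -> sig1 (fun x => u x = v x).
Proof.
move=> cu cv; have := sig1_dec (comp_eqn cu cv).
by apply: sig1_iff => x; split=> /eqP.
Qed.

Lemma sig1_and (R R' : X -> Prop) : sig1 R -> sig1 R' ->
  sig1 (fun x => R x /\ R' x).
Proof.
move=> [d cd dE] [d' cd' d'E].
exists (fun p => d (p.1, (pair_decode P p.2).1) && d' (p.1,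
  (pair_decode P p.2).2)).
  by computable.
move=> x; rewrite dE d'E; split=> [[[w dw] [w' dw']]|[w /andP[dw dw']]].
  by exists (P (w, w')); rewrite /= pair_codeK dw dw'.
by split; [exists (pair_decode P w).1|exists (pair_decode P w).2].
Qed.

Lemma sig1_or (R R' : X -> Prop) : sig1 R -> sig1 R' ->
  sig1 (fun x => R x \/ R' x).
Proof.
move=> [d cd dE] [d' cd' d'E].
(* One number serves as witness for either side. The disjunction is written by De Morgan, since
   [computable] knows only negation and conjunction. *)
exists (fun p => ~~ (~~ d p && ~~ d' p)); first by computable.
move=> x; rewrite dE d'E; split=> [[[w dw]|[w dw]]|[w]].
- by exists w; rewrite dw.
- by exists w; rewrite dw andbF.
- by rewrite negb_and !negbK => /orP[dw|dw]; [left|right]; exists w.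
Qed.

End Sig1.

Section Sig1Quantifiers.
Context {X : Type} {eX : enc X}.

Lemma sig1_subst Y {eY : enc Y} (R : Y -> Prop) (u : X -> Y) :
  sig1 R -> comp u -> sig1 (fun x => R (u x)).
Proof.
move=> [d cd dE] cu; exists (fun p => d (u p.1, p.2)) => //; computable.
Qed.

Lemma sig1_ex (R : X -> nat -> Prop) :
  sig1 (fun p : X * nat => R p.1 p.2) -> sig1 (fun x => exists n, R x n).
Proof.
move=> [d cd dE].
exists (fun p => d (p.1, (pair_decode P p.2).1, (pair_decode P p.2).2)).
  by computable.
move=> x; split=> [[n /(dE (x, n))[w dw]]|[w dw]].
  by exists (P (n, w)); rewrite /= pair_codeK.
by exists (pair_decode P w).1; apply/(dE (x, _)); exists (pair_decode P w).2.
Qed.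

(** Finitely many witnesses have a common bound. That bound is the witness for the whole statement,
    and both quantifiers that remain under it are bounded. *)
Lemma sig1_all (u : X -> nat) (R : X -> nat -> Prop) :
  comp u -> sig1 (fun p : X * nat => R p.1 p.2) ->
  sig1 (fun x => forall k, k < u x -> R x k).
Proof.
move=> cu [d cd dE].
exists (fun p => all (fun k => ~~ all (fun w => ~~ d (p.1, k, w)) (iota 0 p.2))
                     (iota 0 (u p.1))).
  by computable.
move=> x; split=> [Rx|[b /allP dx] k ku]; last first.
  have /dx/= : k \in iota 0 (u x) by rewrite mem_iota.
  by move=> /allPn[w _ /negbNE dw]; apply/(dE (x, k)); exists w.
(* Choice needs a value at every [k]; from [u x] on, the irrelevant value 0 is taken. *)
have [w dw] : {w : nat -> nat & forall k, k < u x -> d (x, k, w k)}.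
  apply: (@choice nat nat (fun k n => is_true (k < u x) ->
    is_true (d (x, k, n)))) => k.
  case: (ltnP k (u x)) => [/Rx/(dE (x, k))[w dw]|_]; [by exists w|by exists 0].
have [b wb] : exists b, forall k, k < u x -> w k < b.
  exists (\max_(k < u x) w k).+1 => k ku.
  by rewrite ltnS (bigmax_sup (Ordinal ku)).
exists b; apply/allP => k; rewrite mem_iota /= => ku.
by apply/allPn; exists (w k); rewrite ?mem_iota ?negbK ?wb ?dw.
Qed.

Lemma sig1_ord n (R : 'I_n -> X -> Prop) :
  (forall i, sig1 (R i)) -> sig1 (fun x => forall i, R i x).
Proof.
elim: n R => [|n IH] R sR.
  by apply: (sig1_iff _ (sig1_dec (comp_cst (true : nat)))) => x;
    split=> // _ [].
apply: (sig1_iff _ (sig1_and (sR ord0) (IH _ (fun i => sR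
  (lift ord0 i))))) => x.
split=> [[R0 RS] i|Rx //]; by case: (unliftP ord0 i) => [j ->|->].
Qed.

(** Search for a pair of a value and a witness for it, then keep the value, which need not be the
    least possible one. *)
Lemma sig1_choice (R : X -> nat -> Prop) :
  sig1 (fun p : X * nat => R p.1 p.2) -> (forall x, exists y, R x y) ->
  exists2 f : X -> nat, comp f & forall x, R x (f x).
Proof.
move=> [d cd dE] ex.
have [||m cm mE] := @comp_least X _
  (fun x y => d (x, (pair_decode P y).1, (pair_decode P y).2)).
- by computable.
- move=> x; have [y /(dE (x, y))[w dw]] := ex x.
  by exists (P (y, w)); rewrite pair_codeK.
exists (fun x => (pair_decode P (m x)).1); first by computable.
move=> x; apply/(dE (x, _)); exists (pair_decode P (m x)).2.
by have /searchP[] := mE x.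
Qed.

(** Every number is read as a candidate together with a witness. If the witness is wrong, the known
    member [g x] is listed instead, which keeps the enumeration total, uniformly in [x]. *)
Lemma sig1_range (R : X -> nat -> Prop) (g : X -> nat) :
  sig1 (fun p : X * nat => R p.1 p.2) -> comp g -> (forall x, R x (g x)) ->
  exists2 k : X -> nat -> nat, comp (fun p => k p.1 p.2) &
    forall x, range (k x) = R x.
Proof.
move=> [d cd dE] cg Rg.
exists (fun x n => if d (x, (pair_decode P n).1, (pair_decode P n).2)
                   then (pair_decode P n).1 else g x).
  by apply: comp_if; computable.
move=> x; apply/seteqP; split=> [_ [n _ <-]|y /(dE (x, y))[w dw]] /=.
  by case: ifP => [dw|_]; [apply/(dE (x, _));
    exists (pair_decode P n).2|exact: Rg].
by exists (P (y, w)); rewrite // pair_codeK /= dw.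
Qed.

End Sig1Quantifiers.

(** Decomposes a relation by its connectives; atoms of other shapes are left as goals to be closed
    by hand. *)
Ltac semidecidable := cbv beta; try assumption;
  lazymatch goal with
  | |- sig1 (fun x => @?R x /\ @?S x) =>
      apply (sig1_and (R := R) (R' := S)); semidecidable
  | |- sig1 (fun x => @?R x \/ @?S x) =>
      apply (sig1_or (R := R) (R' := S)); semidecidable
  | |- sig1 (fun x => exists n : nat, @?R x n) =>
      apply (sig1_ex (R := R)); semidecidable
  | |- sig1 (fun x => forall k : nat, is_true (k < @?u x) -> @?R x k) =>
      apply (sig1_all (u := u) (R := R)); [computable|semidecidable]
  | |- sig1 (fun x => is_true (@?b x)) =>
      apply (sig1_dec (b := b)); computable
  | |- sig1 (fun x => @?u x = @?v x :> nat) =>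
      apply (sig1_eq (u := u) (v := v)); computable
  | H : sig1 ?R |- sig1 (fun x => ?R (@?u x)) =>
      apply (sig1_subst (u := u) H); computable
  | |- _ => idtac
  end.

(** * Semidecidability of the graphs of mu-recursive functions *)

Definition fcons X n (a : X -> nat) (u : 'I_n -> X -> nat) : 'I_n.+1 -> X ->
  nat :=
  fun i => if unlift ord0 i is Some j then u j else a.

Lemma fconsE X n (a : X -> nat) (u : 'I_n -> X -> nat) x :
  [tuple fcons a u i x | i < n.+1] = [tuple of a x :: [tuple u i x | i < n]].
Proof.
apply: eq_from_tnth => i; rewrite tnth_mktuple /fcons.
by case: unliftP => [j ->|->]; rewrite ?tnthS ?tnth_mktuple.
Qed.

Lemma comp_fcons X {eX : enc X} n (a : X -> nat) (u : 'I_n -> X -> nat) :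
  comp a -> (forall i, comp (u i)) -> forall i, comp (fcons a u i).
Proof. by move=> ca cu i; rewrite /fcons; case: unliftP. Qed.

(** The intermediate values are collected in one sequence, so that after coding a single number
    quantifier describes the composition. *)
Lemma pfn_compP n m (f : pfn m) (g : 'I_m -> pfn n) t v :
  pfn_comp f g t = Some v <->
  exists s : seq nat, (forall i : 'I_m, g i t = Some (nth 0 s i)) /\
    f [tuple nth 0 s i | i < m] = Some v.
Proof.
rewrite /pfn_comp; split=> [|[s [gs fs]]].
  case: forallP => // gt ft; exists [tuple odflt 0 (g i t) | i < m].
  have nthE (i : 'I_m) : nth 0 [tuple odflt 0 (g j t) | j < m] i = odflt 0
    (g i t).
    by rewrite -tnth_nth tnth_mktuple.
  split=> [i|]; first by rewrite nthE; have := gt i; case: (g i t).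
  by rewrite -ft; congr f; apply: eq_mktuple => i; rewrite nthE.
have -> : [forall i, isSome (g i t)] by apply/forallP => i; rewrite gs.
by rewrite -fs; congr f; apply: eq_mktuple => i; rewrite gs.
Qed.

(** The sequence [s] is the whole course of values of the recursion, and each of its steps can be
    checked locally. *)
Lemma pfn_recP n (f : pfn n) (g : pfn n.+2) y t v :
  pfn_rec f g y t = Some v <->
  exists s : seq nat, [/\ f t = Some (nth 0 s 0),
    forall z, z < y -> g [tuple of z :: nth 0 s z :: t] = Some (nth 0 s z.+1)
    & nth 0 s y = v].
Proof.
split=> [|[s [fs gs <-]]]; last first.
  elim: y gs => // y IH gs /=; rewrite IH; first exact: gs.
  by move=> z /ltnW; apply: gs.
pose w z := odflt 0 (pfn_rec f g z t) => Ev.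
(* A defined value at [y] forces all earlier values to be defined, so the default in [w] is never
   reached up to [y]. *)
have some z : z <= y -> pfn_rec f g z t = Some (w z).
  rewrite /w => zy; suff : isSome (pfn_rec f g z t) by case: pfn_rec.
  have : isSome (pfn_rec f g y t) by rewrite Ev.
  elim: (y) zy => [|y' IH]; first by rewrite leqn0 => /eqP ->.
  rewrite leq_eqVlt ltnS => /orP[/eqP -> //|/IH] h ySome; apply: h.
  by move: ySome => /=; case: pfn_rec.
have nthE z : z <= y -> nth 0 (mkseq w y.+1) z = w z.
  by move=> zy; rewrite nth_mkseq.
exists (mkseq w y.+1); split=> [|z zy|]; rewrite !nthE ?(ltnW zy) //.
- exact: some 0 _.
- by rewrite -(some z.+1) //= (some z) // ltnW.
- by rewrite /w Ev.
Qed.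

(* Kleene's normal form; quantifying over computable arguments [u], [v] makes a
   coding of tuples of arbitrary length unnecessary. *)
Lemma sig1_graph n (f : pfn n) : mu_recursive f ->
  forall X (eX : enc X) (u : 'I_n -> X -> nat) (v : X -> nat),
  (forall i, comp (u i)) -> comp v ->
  sig1 (fun x => f [tuple u i x | i < n] = Some (v x)).
Proof.
elim=> {n f} [n||n i|n m f g _ IHf _ IHg|n f g _ IHf _ IHg|n f h _ IHf hE] X eX
  u v cu cv.
- apply: (sig1_iff _ (sig1_eq (comp_cst 0) cv)) => x.
  by split=> [->|[]].
- apply: (sig1_iff _ (sig1_eq (comp_succ (cu ord0)) cv)) => x.
  by rewrite /thead tnth_mktuple; split=> [->|[]].
- apply: (sig1_iff _ (sig1_eq (cu i) cv)) => x.
  by rewrite tnth_mktuple; split=> [->|[]].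
- apply: (sig1_iff (R := fun x => exists s,
    (forall i : 'I_m, g i [tuple u j x | j < n] = Some (nth 0
      (seq_decode c s) i)) /\
    f [tuple nth 0 (seq_decode c s) i | i < m] = Some (v x))).
    move=> x; rewrite pfn_compP; split=> [[s sP]|[s sP]].
      by exists (seq_decode c s).
    by exists (seq_code c s); rewrite seq_codeK.
  apply: sig1_ex; apply: sig1_and.
    apply: sig1_ord => i; apply: (IHg _ _ _ (fun j p => u j p.1));
      last by computable.
    by move=> j; have := cu j => cuj; computable.
  apply: (IHf _ _ (fun i p => nth 0 (seq_decode c p.2) i)); last by computable.
  by move=> i; computable.
- pose u' (i : 'I_n) := u (lift ord0 i).
  have cu' i : comp (u' i) by exact: cu.
  have c0 := cu ord0.
  apply: (sig1_iff (R := fun x => exists s,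
    f [tuple u' i x | i < n] = Some (nth 0 (seq_decode c s) 0) /\
    (forall z, z < u ord0 x ->
      g [tuple of z :: nth 0 (seq_decode c s) z :: [tuple u' i x | i < n]] =
      Some (nth 0 (seq_decode c s) z.+1)) /\
    nth 0 (seq_decode c s) (u ord0 x) = v x)).
    move=> x.
    have -> : [tuple of behead [tuple u i x | i < n.+1]] = [tuple u' i x | i <
      n].
      apply: eq_from_tnth => i; rewrite tnth_behead tnth_mktuple !tnth_mktuple.
      by congr u; apply: val_inj; rewrite /= inordK // ltnS.
    rewrite /thead tnth_mktuple pfn_recP.
    split=> [[s [? [? ?]]]|[s [? ? ?]]]; first by exists (seq_decode c s).
    by exists (seq_code c s); rewrite seq_codeK.
  semidecidable.
  + apply: (IHf _ _ (fun i p => u' i p.1)); last by computable.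
    by move=> i; have := cu' i => cu'i; computable.
  + apply: (sig1_iff (R := fun p : X * nat * nat => g [tuple fcons
    (fun p => p.2)
        (fcons (fun p => nth 0 (seq_decode c p.1.2) p.2)
          (fun i p => u' i p.1.1)) i p
        | i < n.+2] = Some (nth 0 (seq_decode c p.1.2) p.2.+1))).
      by move=> p; rewrite !fconsE.
    apply: IHg; last by computable.
    apply: comp_fcons; first by computable.
    apply: comp_fcons; first by computable.
    by move=> i; have := cu' i => cu'i; computable.
- apply: (sig1_iff (R := fun x =>
    f [tuple of v x :: [tuple u i x | i < n]] = Some 0 /\
    (forall z, z < v x -> exists w,
      f [tuple of z :: [tuple u i x | i < n]] = Some w.+1))).
    by move=> x; rewrite hE.
  semidecidable.
  + have := IHf _ _ (fcons v u) (fun=> 0) (comp_fcons cv cu) (comp_cst 0).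
    by apply: sig1_iff => x; rewrite fconsE.
  + apply: (sig1_iff (R := fun p : X * nat * nat => f [tuple fcons
    (fun p => p.1.2)
        (fun i p => u i p.1.1) i p | i < n.+1] = Some p.2.+1)).
      by move=> p; rewrite fconsE.
    apply: IHf; last by computable.
    apply: comp_fcons; first by computable.
    by move=> i; have := cu i => cui; computable.
Qed.

(** * Computably enumerable sets as semidecidable relations *)

Lemma isSomeP T (o : option T) : isSome o <-> exists y, o = Some y.
Proof. by split=> [|[y ->]//]; case: o => // y; exists y. Qed.

Lemma sig1_pcomputable1 q :
  pcomputable1 q -> sig1 (fun p : nat * nat => q p.1 = Some p.2).
Proof.
move=> /sig1_graph/(_ _ _ (fun _ p => p.1) (fun p => p.2)) sq.
apply: sig1_iff (sq _ _) => [p|_|]; [|by computable..].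
by rewrite /thead tnth_mktuple.
Qed.

Lemma sig1_pcomputable2 q :
  pcomputable2 q -> sig1 (fun p : nat * nat * nat => q p.1.1 p.1.2 = Some p.2).
Proof.
move=> /sig1_graph/(_ _ _ (fun i p => if i == ord0 then p.1.1 else p.1.2)
  (fun p => p.2)) sq.
apply: sig1_iff (sq _ _) => [p|i|]; last by computable.
  by rewrite !tnth_mktuple.
by case: (i == ord0); computable.
Qed.

(** A domain is the projection of a graph, which is semidecidable by [sig1_graph]. Conversely, the
    search for a witness halts exactly on the members of [X]. *)
Lemma ceP X : ce X <-> sig1 X.
Proof.
split=> [[q mq ->]|[d cd dE]].
  have sq := sig1_pcomputable1 mq.
  apply: (sig1_iff (R := fun x => exists y, q x = Some y)).
    by move=> x; rewrite /dom /= isSomeP.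
  by apply: sig1_ex.
exists (fun x => search (fun w => d (x, w))).
  apply: (mu_search (d := fun t w => d (thead t, w))).
  have : comp (fun p : nat * nat => ~~ d (p.1, p.2) : nat) by computable.
  move=> /(comp_uncurry (fun x w => ~~ d (x, w)))/mu_total_R2/(_
    (mu_total_nth 2 1) (mu_total_nth 2 0)).
  by apply: mu_total_eq => t; case/tupleP: t => y t; case/tupleP: t => x t;
    rewrite /thead !(tnth_nth 0).
by apply/seteqP; split=> x; rewrite /dom /= search_some -dE.
Qed.

Lemma ce_pairP (r : nat -> nat -> Prop) :
  ce (pair_set P r) <-> sig1 (fun p : nat * nat => r p.1 p.2).
Proof.
have E n : pair_set P r n <-> r (pair_decode P n).1 (pair_decode P n).2.
  split=> [[[i j] rij <-]|rn]; first by rewrite pair_codeK.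
  by exists (pair_decode P n); rewrite ?pair_decodeK.
rewrite ceP; split=> sr.
  apply: (sig1_iff (R := fun p => pair_set P r (P p))).
    by move=> p; rewrite E pair_codeK.
  by apply: (sig1_subst (u := fun p => P p) sr); computable.
apply: (sig1_iff (R := fun n => (fun p => r p.1 p.2) (pair_decode P n))).
  by move=> n; rewrite E.
by apply: (sig1_subst (u := fun n => pair_decode P n) sr); computable.
Qed.

Lemma sig1_total f : sig1 (fun p : nat * nat => f p.1 = p.2) -> R1 f.
Proof.
move=> sf; have [|g cg gE] := @sig1_choice nat _ (fun x y => f x = y) sf.
  by move=> x; exists (f x).
by rewrite (_ : f = g) //; apply: funext.
Qed.

(** * Effective indices of c.e. sets *)

Section Goedel.
Variables (phi : nat -> pfun1) (phi_goedel : goedel_numbering phi).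

Lemma sig1_W : sig1 (fun p : nat * nat => W phi p.1 p.2).
Proof.
have [_ /sig1_pcomputable2 sphi _] := phi_goedel.
apply: (sig1_iff (R := fun p => exists y, phi p.1 p.2 = Some y)).
  by move=> p; rewrite /W /dom /= isSomeP.
exact: sig1_ex.
Qed.

(** The search for a witness is a binary partial computable function whose section at [i] has domain
    [R i]; the s-m-n property turns [i] into an index of that section. *)
Lemma sig1_smn (R : nat -> nat -> Prop) :
  sig1 (fun p : nat * nat => R p.1 p.2) ->
  exists2 s, R1 s & forall i, W phi (s i) = R i.
Proof.
move=> [d cd dE].
have [_ _ /(_ (fun i x => search (fun w => d (i, x, w))))[|s ms sE]] :=
  phi_goedel.
  apply: (mu_search (d := fun t w => d (tnth t ord0, tnth t ord_max, w))).
  have m3 := mu_total_nth 3.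
  have mP := mu_total_R2 (pair_computable P).
  have cn : comp (fun p : nat * nat * nat => ~~ d p : nat) by computable.
  apply: (mu_total_eq _ (mu_total_R1 cn (mP _ _ _ (mP _ _ _ (m3 1) (m3 2))
    (m3 0)))).
  case/tupleP=> y t; case/tupleP: t => x t; case/tupleP: t => z t.
  by rewrite /= !pair_codeK !(tnth_nth 0).
exists s => // i; rewrite /W sE.
by apply/seteqP; split=> x; rewrite /dom /= search_some -(dE (i, x)).
Qed.

End Goedel.

(** * The canonical numbering of the initial segment functions *)

Section CanonicalNumbering.
Variables (A : set nat) (A_infinite : infinite_set A) (fA : nat -> nat).
Hypotheses (fA_computable : R1 fA) (fA_range : range fA = A).

Lemma infinite_set_gt n : exists2 a, A a & n < a.
Proof.
apply: contrapT => noa; apply: A_infinite.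
apply: (sub_finite_set _ (finite_II n.+1)) => a Aa /=.
by rewrite ltnNge; apply/negP => na; apply: noa; exists a.
Qed.

Definition hat_len n := fA (pair_decode P n).2.
Definition hat_val n x := nth 0 (seq_decode c (pair_decode P n).1) x.

(** Padding with zeros needs no case of its own, as [nth] already returns 0 past the end of the
    sequence. *)
Lemma alpha_hatE n x : alpha_hat P c fA n x =
  if x < hat_len n then Some (hat_val n x) else None.
Proof.
rewrite /alpha_hat /hat_len /hat_val; case: (pair_decode P n) => a b /=.
rewrite leq_min; case: (ltnP x (size _)) => /= xs.
  by case: (x < fA b).
by case: ifP => // _; rewrite nth_default.
Qed.

Lemma hat_exists l (f : nat -> nat) : A l ->
  exists n, alpha_hat P c fA n = fun x => if x < l then Some (f x) else None.
Proof.
rewrite -fA_range => -[b _ <-]; exists (P (seq_code c (mkseq f (fA b)), b)).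
apply: funext => x; rewrite alpha_hatE /hat_len /hat_val pair_codeK /=
  seq_codeK.
by case: ifP => // xb; rewrite nth_mkseq.
Qed.

(** Definedness recovers the length and the values below it are finite in number. Equality of
    initial segment functions is therefore decidable, and new ones can be found by computable
    search. *)
Lemma initial_eqP l l' f f' :
  ((fun x => if x < l then Some (f x) else None) =
   (fun x => if x < l' then Some (f' x) else None) :> pfun1) <->
  (l == l') && all (fun x => f x == f' x) (iota 0 l).
Proof.
split=> [E|/andP[/eqP <- /allP ff']]; last first.
  apply: funext => x; case: ifP => // xl; congr Some; apply/eqP/ff'.
  by rewrite mem_iota.
have lE x : (x < l) = (x < l') by have /(congr1 isSome) := congr1 (@^~ x) E;
  do 2!case: ifP.
have -> : l = l'.
  by apply/eqP; rewrite eqn_leq leqNgt lE ltnn /= leqNgt -lE ltnn.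
rewrite eqxx /=; apply/allP => x; rewrite mem_iota /= => xl.
by have := congr1 (@^~ x) E; rewrite lE xl => -[->].
Qed.

Definition hat_eq j k :=
  (hat_len j == hat_len k) &&
  all (fun x => hat_val j x == hat_val k x) (iota 0 (hat_len j)).

Lemma hat_eqP j k : hat_eq j k <-> alpha_hat P c fA j = alpha_hat P c fA k.
Proof.
by rewrite (funext (alpha_hatE j)) (funext (alpha_hatE k)) initial_eqP.
Qed.

(** Decidable form of novelty. The test on the length excludes [nowhere], which is already the value
    of [alpha] at 0. *)
Definition fresh b j := (hat_len j != 0) && all (fun k => ~~ hat_eq j k)
  (iota 0 b).

Lemma freshP b j : fresh b j <->
  alpha_hat P c fA j <> nowhere /\
  forall k, k < b -> alpha_hat P c fA j <> alpha_hat P c fA k.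
Proof.
have -> : alpha_hat P c fA j <> nowhere <-> hat_len j != 0.
  split=> [jN|]; last first.
    rewrite -lt0n => j0 /(congr1 (@^~ 0)).
    by rewrite alpha_hatE j0.
  by apply/eqP => j0; apply: jN; apply: funext => x; rewrite alpha_hatE j0.
rewrite /fresh; split=> [/andP[-> /allP jb]|[-> jb]].
  split=> // k kb; rewrite -hat_eqP; apply/negP/jb.
  by rewrite mem_iota.
apply/allP => k; rewrite mem_iota /= => /jb.
by rewrite -hat_eqP => /negP.
Qed.

Lemma comp_hat_len : comp hat_len.
Proof. by have H := fA_computable; rewrite /hat_len; computable. Qed.

Lemma comp_hat_val : comp (fun p => hat_val p.1 p.2).
Proof. by rewrite /hat_val; computable. Qed.

Lemma comp_fresh : comp (fun p => fresh p.1 p.2 : nat).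
Proof.
have cl := comp_hat_len; have cv := (comp_uncurry _).2 comp_hat_val.
by rewrite /fresh /hat_eq; computable.
Qed.

(** As [A] is infinite, it has an element above all the lengths used before [b]; a function of that
    length differs from all earlier ones. *)
Lemma fresh_exists b : exists j, fresh b j.
Proof.
have [l Al lb] := infinite_set_gt (\max_(k < b) hat_len k).
have [j jE] := hat_exists (fun=> 0) Al.
have lj : hat_len j = l.
  have := jE; rewrite (funext (alpha_hatE j)).
  by move/initial_eqP/andP => [/eqP].
exists j; rewrite /fresh lj -lt0n (leq_ltn_trans _ lb) //=.
apply/allP => k; rewrite mem_iota /= => kb; rewrite /hat_eq lj.
by rewrite gtn_eqF // (leq_ltn_trans _ lb) // (bigmax_sup (Ordinal kb)).
Qed.

Definition next b := xget 0 [set j | search (fresh b) = Some j].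

Lemma nextP b : search (fresh b) = Some (next b).
Proof.
have /search_some/isSomeP[j jE] := fresh_exists b.
by rewrite /next; case: xgetP => // /(_ j).
Qed.

Lemma R1_next : R1 next.
Proof.
have [m mm mE] := comp_least comp_fresh fresh_exists.
by rewrite (_ : next = m) //; apply: funext => b; have := mE b;
  rewrite nextP => -[].
Qed.

(* The first [i.+1] values of [alpha] cover [alpha_hat P c fA k] for every
   [k < bound i], and the next value is [alpha_hat] at the first later index
   that gives a new nonempty function. *)
Definition bound i := nat_rect (fun=> nat) 0 (fun _ b => (next b).+1) i.

Lemma R1_bound : R1 bound.
Proof.
have mn := R1_next.
have := @comp_rec nat nat _ _ (fun=> 0) id (fun _ _ b => (next b).+1).
by apply; computable.
Qed.

(** The hypothesis is the statement of [alpha_uptoP] at [i]. It is kept as a premise because the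
    induction proving [alpha_uptoP] itself uses this equivalence. *)
Lemma notin_freshP i j :
  (forall q, q \in alpha_upto P c fA i <->
     q = nowhere \/ exists2 k, k < bound i & q = alpha_hat P c fA k) ->
  alpha_hat P c fA j \notin alpha_upto P c fA i <-> fresh (bound i) j.
Proof.
move=> IH; rewrite freshP; split=> [/negP|[jN jb]].
  rewrite IH => /not_orP[jN jb]; split=> // k kb jk; apply: jb; by exists k.
by apply/negP; rewrite IH => -[//|[k /jb]].
Qed.

(** Identifies the index that the canonical numbering picks by a classical minimum with the result
    of a computable search. *)
Lemma least_notin i :
  (forall q, q \in alpha_upto P c fA i <->
     q = nowhere \/ exists2 k, k < bound i & q = alpha_hat P c fA k) ->
  least [set j | alpha_hat P c fA j \notin alpha_upto P c fA i] = next
    (bound i).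
Proof.
move=> /notin_freshP LE.
have /searchP[fn nmin] := nextP (bound i).
rewrite /least; case: xgetP => [j _ [/LE fj jmin]|/(_ (next (bound i)))[]].
  apply/eqP; rewrite eqn_leq jmin /=; last exact/LE.
  by rewrite leqNgt; apply/negP => /nmin; rewrite fj.
split; first exact/LE.
by move=> k /LE fk; rewrite leqNgt; apply/negP => /nmin; rewrite fk.
Qed.

(** The indices from [bound i] up to the next chosen one are not fresh, by minimality of the search,
    so their functions are listed already. *)
Lemma alpha_uptoP i q : q \in alpha_upto P c fA i <->
  q = nowhere \/ exists2 k, k < bound i & q = alpha_hat P c fA k.
Proof.
elim: i q => [|i IH] q /=.
  by rewrite inE; split=> [/eqP ->|[-> //|[]//]]; left.
rewrite least_notin //; have LE := notin_freshP _ IH.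
have /searchP[fn nmin] := nextP (bound i).
rewrite mem_rcons inE; split=> [/orP[/eqP ->|/IH[->|[k kb ->]]]|].
- by right; exists (next (bound i)).
- by left.
- right; exists k => //; rewrite ltnS leqNgt; apply/negP => nk.
  move: fn => /freshP[_ /(_ (next (bound i)))].
  by move=> /(_ (ltn_trans nk kb)).
- move=> [->|[k]]; first by apply/orP; right; apply/IH; left.
  rewrite ltnS leq_eqVlt => /orP[/eqP -> ->|/nmin kn ->]; first by rewrite eqxx.
  apply/orP; right; apply: contraT => kL; case/negP: kn; exact/LE.
Qed.

Lemma alphaS i : alpha P c fA i.+1 = alpha_hat P c fA (next (bound i)).
Proof. by rewrite /alpha /= last_rcons least_notin // => q;
  exact: alpha_uptoP. Qed.

(** The shift by one makes room for [nowhere] at index 0. The length 0 there makes the entry of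
    [alpha_val] at that index irrelevant. *)
Definition alpha_len i := if i == 0 then 0 else hat_len (next (bound i.-1)).
Definition alpha_val i x := hat_val (next (bound i.-1)) x.

Lemma alphaE i x :
  alpha P c fA i x = if x < alpha_len i then Some (alpha_val i x) else None.
Proof. by case: i => // i; rewrite alphaS alpha_hatE. Qed.

Lemma R1_alpha_len : R1 alpha_len.
Proof.
have mn := R1_next; have mb := R1_bound; have mp := R1_pred; have cl :=
  comp_hat_len.
change (comp (fun i => if i == 0 then 0 else hat_len (next (bound i.-1)))).
by apply: comp_if; computable.
Qed.

Lemma R2_alpha_val : R2 alpha_val.
Proof.
have mn := R1_next; have mb := R1_bound; have mp := R1_pred.
have cv := (comp_uncurry _).2 comp_hat_val.
by apply/comp_uncurry; rewrite /alpha_val; computable.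
Qed.

Lemma alpha_dom i : dom (alpha P c fA i) = `I_(alpha_len i).
Proof. by apply/seteqP; split=> x; rewrite /dom /= alphaE; case: ifP. Qed.

Lemma alpha_range : range (alpha P c fA) = Anf A.
Proof.
apply/seteqP; split=> [_ [[|i] _ <-]|q [q0|[l Al ql]]].
- by left; apply/seteqP; split.
- right; exists (alpha_len i.+1); last exact: alpha_dom.
  by rewrite -fA_range; exists (pair_decode P (next (bound i))).2.
- exists 0 => //; apply: funext => x; apply/esym.
  by have : ~ dom q x by [rewrite q0]; rewrite /dom /=; case: (q x) => // y [].
have [n nE] := hat_exists (fun x => odflt 0 (q x)) Al.
have qn : q = alpha_hat P c fA n.
  apply: funext => x; rewrite nE.
  have : dom q x <-> x < l by rewrite ql.
  by rewrite /dom /=; case: ltnP => xl; case: (q x) => [y|] //= -[h1 h2];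
    first [by have := h2 isT | by have := h1 isT].
(* A fresh index is never below the bound that it was tested against, so the bound grows at each
   stage and passes [n] by stage [n.+1]. *)
have bound_ge i : i <= bound i.
  elim: i => // i IH; rewrite /= ltnS (leq_trans IH) // leqNgt.
  have /searchP[/freshP[_ fn] _] := nextP (bound i).
  by apply/negP => /fn.
have : q \in alpha_upto P c fA n.+1.
  by apply/alpha_uptoP; right; exists n.
(* Each list extends the previous one by a value of [alpha], so every member of a list is such a
   value. *)
elim: (n.+1) => [|m IH] /=; first by rewrite inE => /eqP ->; exists 0.
rewrite mem_rcons inE => /orP[/eqP ->|//].
by exists m.+1; rewrite // /alpha /= last_rcons.
Qed.

Lemma alpha_Anf i : Anf A (alpha P c fA i).
Proof. by rewrite -alpha_range; exists i. Qed.

(** * The domain of initial segment functions *)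

Local Notation al := (alpha P c fA).
Local Notation D := (S1hat A).
Local Notation le := (sub_graph P).

Lemma graphE q n : graph P q n <->
  q (pair_decode P n).1 = Some (pair_decode P n).2.
Proof.
split=> [[[i j] qi <-]|qn]; first by rewrite pair_codeK.
by exists (pair_decode P n); rewrite ?pair_decodeK.
Qed.

Lemma sub_graphP q r : le q r <-> forall x y, q x = Some y -> r x = Some y.
Proof.
split=> [qr x y qx|qr n].
  have /graphE : graph P r (P (x, y)) by apply: qr; exists (x, y).
  by rewrite pair_codeK.
by rewrite !graphE; exact: qr.
Qed.

Lemma sub_graph_order : partial_order D le.
Proof.
split=> [q _|q r _ _ /sub_graphP qr /sub_graphP rq|p q r _ _ _ pq qr].
- exact: subset_refl.
- apply: funext => x; case qx: (q x) => [y|]; first by rewrite (qr _ _ qx).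
  by case rx: (r x) => [y|//]; rewrite -qx (rq _ _ rx).
- exact: subset_trans pq qr.
Qed.

(** Treats the empty function as the initial segment of length 0, whether or not 0 belongs to
    [A]. *)
Lemma AnfP q : Anf A q <-> exists l, (l = 0 \/ A l) /\ dom q = `I_l.
Proof.
split=> [[->|[l Al ->]]|[l [[->|Al] ql]]].
- exists 0; split; first by left.
  by apply/seteqP; split.
- by exists l; split; [right|].
- by left; rewrite ql; apply/seteqP; split.
- by right; exists l.
Qed.

Lemma Anf_S1hat : Anf A `<=` D.
Proof. by move=> q; right. Qed.

Lemma alpha_S1hat i : D (al i).
Proof. exact/Anf_S1hat/alpha_Anf. Qed.

Lemma nowhere_Anf : Anf A nowhere.
Proof. by left; apply/seteqP; split. Qed.

Lemma nowhere_least : is_least D le nowhere.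
Proof. by split=> [|q _]; [exact/Anf_S1hat/nowhere_Anf|exact/sub_graphP]. Qed.

Lemma S1hat_total q : (forall x, q x <> None) -> exists f, q = Defs.total f.
Proof.
move=> qT; exists (fun x => odflt 0 (q x)); apply: funext => x;
  rewrite /Defs.total.
by have := qT x; case: (q x).
Qed.

Lemma S1hat_Anf q x : D q -> q x = None -> Anf A q.
Proof. by case=> // -[f _ <-]. Qed.

Lemma Anf_dom q l x : dom q = `I_l -> (q x <> None) <-> x < l.
Proof.
move=> ql; have : dom q x <-> x < l by rewrite ql.
by rewrite /dom /= => <-; case: (q x) => [y|]; split=> // /(_ erefl).
Qed.

(** * Suprema of directed sets as unions *)

Section Lub.
Variables (L : set pfun1) (L_directed : directed D le L).

(** Directedness makes the union of the members single-valued. If it is total, it lies in the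
    domain. If it is undefined at [x0], all members are initial segments of length at most [x0], and
    the union is the longest of them. *)
Lemma directed_lub : exists s, D s /\
  forall x y, s x = Some y <-> exists2 u, L u & u x = Some y.
Proof.
have [LD L0 Lub] := L_directed.
have [s sE] : {s : pfun1 & forall x y, s x = Some y <->
  exists2 u, L u & u x = Some y}.
  apply: (@choice nat (option nat)
    (fun x o => forall y, o = Some y <-> exists2 u, L u & u x = Some y)) => x.
  case: (pselect (exists y, exists2 u,
    L u & u x = Some y)) => [[y [u Lu ux]]|no].
    exists (Some y) => z; split=> [[<-]|[v Lv vx]]; first by exists u.
    have [w [_ /sub_graphP uw /sub_graphP vw]] := Lub _ _ Lu Lv.
    by rewrite -(uw _ _ ux) (vw _ _ vx).
  by exists None => y; split=> // -[u Lu ux]; case: no; exists y, u.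
exists s; split=> //.
case: (pselect (forall x, s x <> None)) => [/S1hat_total[f ->]|].
  by left; exists f.
move=> /existsNP[x0 /contrapT sx0]; right.
have L_None u : L u -> u x0 = None.
  move=> Lu; case ux: (u x0) => [y|//].
  by have : s x0 = Some y; [apply/sE; exists u|rewrite sx0].
have L_len u : L u -> exists2 l, dom u = `I_l & l <= x0.
  move=> Lu; have /AnfP[l [_ ul]] := S1hat_Anf (LD _ Lu) (L_None _ Lu).
  exists l => //; rewrite leqNgt; apply/negP => /(Anf_dom x0 ul).
  by rewrite L_None.
pose Q l := `[< exists2 u, L u & dom u = `I_l >].
have Q0 : exists l, Q l.
  have [u Lu] := L0; have [l ul _] := L_len _ Lu.
  by exists l; apply/asboolP; exists u.
have Qmax l : Q l -> l <= x0.
  move=> /asboolP[u Lu ul]; have [l' ul' l'x] := L_len _ Lu.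
  suff -> : l = l' by [].
  apply/eqP; rewrite eqn_leq; apply/andP; split; rewrite leqNgt;
    apply/negP => h.
    by have := (Anf_dom l' ul).2 h; move/(Anf_dom l' ul'); rewrite ltnn.
  by have := (Anf_dom l ul').2 h; move/(Anf_dom l ul); rewrite ltnn.
case: (ex_maxnP Q0 Qmax) => l /asboolP[u Lu ul] lmax.
(* Any value of the union comes from some [v]; an upper bound in [L] of [u] and [v] is no longer
   than [u], so [u] is defined there too. *)
suff -> : s = u by exact: S1hat_Anf (LD _ Lu) (L_None _ Lu).
apply: funext => x; case ux: (u x) => [y|]; first by apply/sE; exists u.
case sx: (s x) => [y|//]; have /sE[v Lv vx] := sx.
have [w [Lw /sub_graphP uw /sub_graphP vw]] := Lub _ _ Lu Lv.
have [m wm mx] := L_len _ Lw.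
have ml : m <= l by apply: lmax; apply/asboolP; exists w.
have xm : x < m by apply/(Anf_dom x wm); rewrite (vw _ _ vx).
by have /(Anf_dom x ul) := leq_trans xm ml; rewrite ux.
Qed.

Lemma is_lubP s : is_lub D le L s <->
  D s /\ forall x y, s x = Some y <-> exists2 u, L u & u x = Some y.
Proof.
have lubI r : D r -> (forall x y, r x = Some y <->
  exists2 u, L u & u x = Some y) ->
    is_lub D le L r.
  move=> Dr rE; split=> // [u Lu|v Dv Lv].
    by apply/sub_graphP => x y ux; apply/rE; exists u.
  by apply/sub_graphP => x y /rE[u /Lv/sub_graphP]; apply.
split=> [[Ds Ls sL]|[]]; last exact: lubI.
have [r [Dr rE]] := directed_lub; have [_ Lr rL] := lubI r Dr rE.
have [_ anti _] := sub_graph_order.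
by have -> : s = r by apply: anti; [..|exact: sL|exact: rL].
Qed.

Lemma lub_unique s r : is_lub D le L s -> is_lub D le L r -> s = r.
Proof.
move=> [Ds Ls sL] [Dr Lr rL]; have [_ anti _] := sub_graph_order.
by apply: anti; [..|exact: sL|exact: rL].
Qed.

(** Each point of the supremum comes from some member, and directedness merges finitely many members
    into one. This finiteness argument underlies both compactness and the continuity of
    operators. *)
Lemma directed_seq s (l : seq nat) : is_lub D le L s ->
  (forall n, n \in l -> graph P s n) ->
  exists2 u, L u & forall n, n \in l -> graph P u n.
Proof.
move=> /is_lubP[_ sE]; have [_ [u0 Lu0] Lub] := L_directed.
elim: l => [|n l IH] ls; first by exists u0.
have [|u Lu ul] := IH; first by move=> m ml; apply: ls; rewrite inE ml orbT.
have /graphE/sE[v Lv vn] := ls n (mem_head _ _).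
have [w [Lw uw vw]] := Lub _ _ Lu Lv.
exists w => // m; rewrite inE => /orP[/eqP ->|/ul/uw//].
exact/vw/graphE.
Qed.

End Lub.

Lemma directed_sup L : directed D le L -> exists s, is_lub D le L s.
Proof. by move=> dL; have [s] := directed_lub dL; exists s; apply/is_lubP. Qed.

(** * The way-below relation, the basis and the compact elements *)

Lemma Anf_graph_seq q : Anf A q -> exists l : seq nat, forall n, n \in l <->
  graph P q n.
Proof.
move=> /AnfP[l [_ ql]]; exists [seq P (x, odflt 0 (q x)) | x <- iota 0 l] => n.
split=> [/mapP[x]|/graphE qn].
  rewrite mem_iota /= => /(Anf_dom x ql) + -> => qx.
  by apply/graphE; rewrite pair_codeK /=; case: (q x) qx.
apply/mapP; exists (pair_decode P n).1; last first.
  by rewrite qn /= -surjective_pairing pair_decodeK.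
by rewrite mem_iota; apply/(Anf_dom _ ql); rewrite qn.
Qed.

(** One direction tests the definition on the directed set whose only member is [r]. For the other,
    the finite graph of [q] is contained in a single member of the directed set. *)
Lemma way_belowP q r : Anf A q -> D r -> way_below D le q r <-> le q r.
Proof.
move=> Aq Dr; split=> [|qr L s dL sL rs].
  move=> /(_ [set r] r)[|||_ ->] //.
    split=> [_ ->//||_ _ -> ->]; first by exists r.
    by exists r; split.
  by split=> // [_ ->//|v _]; apply.
have [l lq] := Anf_graph_seq Aq.
have [|u Lu ul] := directed_seq (l := l) dL sL; first by move=> n /lq/qr/rs.
by exists u => // n /lq/ul.
Qed.

Definition below (q : pfun1) : set pfun1 := [set u | Anf A u /\ le u q].

(** Two initial segments of the same function are comparable, the shorter one lying below the longer
    one. *)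
Lemma below_directed q : D q -> directed D le (below q).
Proof.
move=> Dq; split=> [u [/Anf_S1hat//]||u v [Au uq] [Av vq]].
  by exists nowhere; split; [exact: nowhere_Anf|exact/sub_graphP].
have /AnfP[l [_ ul]] := Au; have /AnfP[m [_ vm]] := Av.
have shorter r s k k' : dom r = `I_k -> dom s = `I_k' -> k <= k' ->
    le r q -> le s q -> le r s.
  move=> rk sk' kk' /sub_graphP rq /sub_graphP sq; apply/sub_graphP => x y rx.
  have xk : x < k by apply/(Anf_dom x rk); rewrite rx.
  have := (Anf_dom x sk').2 (leq_trans xk kk').
  by case sx: (s x) => [z|//] _; rewrite -(sq _ _ sx) (rq _ _ rx).
have [lm|/ltnW ml] := leqP l m.
  by exists v; split=> //; exact: shorter ul vm lm uq vq.
by exists u; split=> //; exact: shorter vm ul ml vq uq.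
Qed.

(** A total function is cut off at an element of [A] beyond [x], which exists since [A] is infinite;
    any other [q] is itself an initial segment function. *)
Lemma below_graph q x y : D q ->
  q x = Some y <-> exists2 u, below q u & u x = Some y.
Proof.
move=> Dq; split=> [qx|[u [_ /sub_graphP uq] /uq//]].
case: Dq qx => [[f _ <-]|Aq] qx; last by exists q => //; split=> //;
  exact: subset_refl.
have [l Al xl] := infinite_set_gt x.
exists (fun z => if z < l then Some (f z) else None); last by rewrite xl.
split; last by apply/sub_graphP => z w; case: ifP.
apply/AnfP; exists l; split; first by right.
by apply/seteqP; split=> z; rewrite /dom /=; case: ifP.
Qed.

Lemma below_lub q : D q -> is_lub D le (below q) q.
Proof.
move=> Dq; apply/(is_lubP (below_directed Dq)); split=> // x y.
exact: below_graph.
Qed.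

Lemma Anf_basis : is_basis D le (Anf A).
Proof.
split=> [|q Dq]; first exact: Anf_S1hat.
exists (below q); split; [|exact: below_directed|exact: below_lub].
by move=> u [Au uq]; split=> //; exact/way_belowP.
Qed.

(** A compact [q], being the supremum of [below q], lies under some member of that set and hence
    equals it. *)
Lemma compactE : compact_elements D le = Anf A.
Proof.
apply/seteqP; split=> [q [Dq]|q Aq]; last first.
  split; first exact: Anf_S1hat.
  by apply/way_belowP => //; exact: Anf_S1hat.
move=> /(_ _ _ (below_directed Dq) (below_lub Dq) (subset_refl (A :=
  _)))[u [Au uq] qu].
have [_ anti _] := sub_graph_order.
by rewrite (anti q u) //; exact: Anf_S1hat.
Qed.

Lemma S1hat_domain : is_domain D le.
Proof.
split; [exact: sub_graph_order|by exists nowhere; exact: nowhere_least|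
        exact: directed_sup|by exists (Anf A); exact: Anf_basis].
Qed.

(** * Effectivity *)

Lemma alpha_leP i q : le (al i) q <->
  forall x, x < alpha_len i -> q x = Some (alpha_val i x).
Proof.
rewrite sub_graphP; split=> [iq x xi|iq x y].
  by apply: iq; rewrite alphaE xi.
by rewrite alphaE; case: ifP => // xi [<-]; exact: iq.
Qed.

Lemma way_below_alphaP i q : D q -> way_below D le (al i) q <-> le (al i) q.
Proof. by move=> Dq; apply: way_belowP => //; exact: alpha_Anf. Qed.

(** An initial segment lies below [Q x] iff finitely many equations hold, so a semidecidable graph
    gives a semidecidable order relation. The converse is [sig1_of_le_alpha], as a function is the
    union of its initial segments. *)
Lemma sig1_le_alpha X (eX : enc X) (u : X -> nat) (Q : X -> pfun1) :
  comp u -> sig1 (fun p : X * nat * nat => Q p.1.1 p.1.2 = Some p.2) ->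
  sig1 (fun x => le (al (u x)) (Q x)).
Proof.
move=> cu sQ; have ml := R1_alpha_len; have mv := R2_alpha_val.
apply: (sig1_iff (R := fun x => forall k, k < alpha_len (u x) ->
    Q x k = Some (alpha_val (u x) k))).
  by move=> x; rewrite alpha_leP.
semidecidable.
have cv : comp (fun p : X * nat => (p, alpha_val (u p.1) p.2)) by computable.
exact: (sig1_subst sQ cv).
Qed.

Lemma alpha_graphP q x y : D q ->
  q x = Some y <-> exists i, le (al i) q /\ al i x = Some y.
Proof.
move=> Dq; rewrite below_graph //; split=> [[u [Au uq] ux]|[i [iq ix]]].
  by move: Au uq ux; rewrite -alpha_range => -[i _ <-]; exists i.
by exists (al i) => //; split=> //; exact: alpha_Anf.
Qed.

Lemma sig1_alpha : sig1 (fun p : nat * nat * nat => al p.1.1 p.1.2 = Some p.2).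
Proof.
have ml := R1_alpha_len; have mv := R2_alpha_val.
apply: (sig1_iff (R := fun p : nat * nat * nat => p.1.2 < alpha_len p.1.1 /\
    alpha_val p.1.1 p.1.2 = p.2)).
  move=> p; rewrite alphaE; split=> [[-> ->]//|].
  by case: ifP => // _ [->].
by semidecidable.
Qed.

Lemma sig1_of_le_alpha X (eX : enc X) (Q : X -> pfun1) : (forall x, D (Q x)) ->
  sig1 (fun p : X * nat => le (al p.2) (Q p.1)) ->
  sig1 (fun p : X * nat * nat => Q p.1.1 p.1.2 = Some p.2).
Proof.
move=> DQ sQ; have sa := sig1_alpha.
apply: (sig1_iff (R := fun p : X * nat * nat => exists i,
    le (al i) (Q p.1.1) /\ al i p.1.2 = Some p.2)).
  by move=> p; rewrite alpha_graphP.
apply: sig1_ex; apply: sig1_and.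
  by apply: (sig1_subst (u := fun p : X * nat * nat * nat =>
    (p.1.1.1, p.2)) sQ); computable.
by apply: (sig1_subst (u := fun p : X * nat * nat * nat =>
  (p.2, p.1.1.2, p.1.2)) sa); computable.
Qed.

Lemma alpha_effectively_given : effectively_given D le P al (Anf A).
Proof.
split; [exact: S1hat_domain|exact: Anf_basis|exact: alpha_range|].
apply/ce_pairP; apply: (sig1_iff (R :=
  fun p : nat * nat => le (al p.1) (al p.2))).
  by move=> p; rewrite way_below_alphaP //; exact: alpha_S1hat.
apply: (sig1_le_alpha (u := fun p : nat * nat => p.1) (Q := fun p => al p.2));
  first by computable.
have sa := sig1_alpha.
by apply: (sig1_subst (u := fun p : nat * nat * nat * nat =>
  (p.1.1.2, p.1.2, p.2)) sa); computable.
Qed.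

Lemma S1_sub_S1hat : S1 A `<=` D.
Proof. by move=> q [[f _ <-]|Aq]; [left; exists f|right]. Qed.

Lemma S1_sig1 q : D q -> sig1 (fun p : nat * nat => q p.1 = Some p.2) -> S1 A q.
Proof.
case=> [[f _ <-] sf|]; last by right.
left; exists f => //; apply: sig1_total.
by apply: sig1_iff sf => p; rewrite /Defs.total; split=> [[]|->].
Qed.

Lemma sig1_S1 q : S1 A q -> sig1 (fun p : nat * nat => q p.1 = Some p.2).
Proof.
case=> [[f mf <-]|]; first exact: sig1_pcomputable1.
rewrite -alpha_range => -[i _ <-].
by apply: (sig1_subst (u := fun p : nat * nat => (i, p.1, p.2)) sig1_alpha);
  computable.
Qed.

Lemma computable_elementsE : computable_elements D le al = S1 A.
Proof.
apply/seteqP; split=> [q [Dq /ceP sq]|q Sq].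
  apply: S1_sig1 => //.
  have {}sq : sig1 (fun i => le (al i) q).
    by apply: sig1_iff sq => i; rewrite /= way_below_alphaP.
  (* A single function is treated as a constant family, whose dummy index is later set to 0. *)
  have := @sig1_of_le_alpha nat enc_nat (fun=> q) (fun=> Dq).
  move=> /(_ (sig1_subst sq (comp_snd comp_id))) sg.
  by apply: (sig1_subst (u := fun p : nat * nat => (0, p.1, p.2)) sg);
    computable.
have Dq := S1_sub_S1hat Sq; split=> //; apply/ceP.
apply: (sig1_iff (R := fun i => le (al i) q)).
  by move=> i; rewrite /= way_below_alphaP.
apply: (sig1_le_alpha (u := fun i : nat => i) (Q := fun=> q));
  first by computable.
by apply: (sig1_subst (u := fun p : nat * nat * nat => (p.1.2, p.2))
  (sig1_S1 Sq)); computable.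
Qed.

Lemma ext_graph1E q n : ext_graph1 P q n <-> (pair_decode P n).2 = 0 \/
  exists v, q (pair_decode P n).1 = Some v /\ (pair_decode P n).2 = v.+1.
Proof.
split=> [[[y _ <-]|[x [v [qx ->]]]]|[n0|[v [qx nv]]]]; rewrite ?pair_codeK.
- by left.
- by right; exists v.
- by left; exists (pair_decode P n).1;
  rewrite // -n0 -surjective_pairing pair_decodeK.
- right; exists (pair_decode P n).1, v; split=> //.
  by rewrite -nv -surjective_pairing pair_decodeK.
Qed.

Lemma ext_graph2E (q : pfun2) n : ext_graph2 P q n <->
  (pair_decode P n).2 = 0 \/
  exists v, q (pair_decode P (pair_decode P n).1).1 (pair_decode P
    (pair_decode P n).1).2
    = Some v /\ (pair_decode P n).2 = v.+1.
Proof.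
split=> [[[y _ <-]|[x [x' [v [qx ->]]]]]|[n0|[v [qx nv]]]]; rewrite ?pair_codeK.
- by left.
- by right; exists v.
- left; exists (pair_decode P (pair_decode P n).1) => //.
  by rewrite pair_decodeK -n0 -surjective_pairing pair_decodeK.
- right; exists (pair_decode P (pair_decode P n).1).1.
  exists (pair_decode P (pair_decode P n).1).2, v; split=> //.
  by rewrite -surjective_pairing pair_decodeK -nv -surjective_pairing
    pair_decodeK.
Qed.

(** * Quasi-Gödel numberings and admissible numberings *)

Section Numberings.
Variables (theta : nat -> pfun1) (theta_range : range theta = S1 A).

Lemma theta_S1 j : S1 A (theta j).
Proof. by rewrite -theta_range; exists j. Qed.

Lemma theta_S1hat j : D (theta j).
Proof. exact/S1_sub_S1hat/theta_S1. Qed.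

Lemma A1P : A1 D le P al theta <->
  sig1 (fun p : nat * nat * nat => theta p.1.1 p.1.2 = Some p.2).
Proof.
rewrite /A1 ce_pairP; split=> [sA|st].
  apply: (sig1_of_le_alpha theta_S1hat).
  apply: sig1_iff (sig1_subst sA (comp_pair (comp_snd comp_id)
    (comp_fst comp_id))) => p.
  by rewrite way_below_alphaP //; exact: theta_S1hat.
apply: (sig1_iff (R := fun p : nat * nat => le (al p.1) (theta p.2))).
  by move=> p; rewrite way_below_alphaP //; exact: theta_S1hat.
apply: (sig1_le_alpha (u := fun p : nat * nat => p.1) (Q :=
  fun p => theta p.2)); first by computable.
by apply: (sig1_subst (u := fun p : nat * nat * nat * nat =>
  (p.1.1.2, p.1.2, p.2)) st); computable.
Qed.

Lemma QGN1P : QGN1 P theta <->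
  sig1 (fun p : nat * nat * nat => theta p.1.1 p.1.2 = Some p.2).
Proof.
split=> [[h mh hE]|st].
  apply: (sig1_iff (R := fun p => exists t, h t = P (P
    (p.1.1, p.1.2), p.2.+1))).
    move=> p; have -> : (exists t, h t = P (P (p.1.1, p.1.2), p.2.+1)) <->
        ext_graph2 P theta (P (P (p.1.1, p.1.2), p.2.+1)).
      by rewrite -hE; split=> -[t]; [exists t|move=> _ ht; exists t].
    rewrite ext_graph2E pair_codeK /= pair_codeK /=.
    by split=> [[//|[v [-> [->]]]//]|->]; right; exists p.2.
  by semidecidable.
(* The extended graph is enumerated as a constant family. Its pairs with second component 0 supply
   the default member. *)
have [|||k ck kE] := @sig1_range nat _ (fun _ => ext_graph2 P theta) (fun=> P
  (P (0, 0), 0)).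
- apply: (sig1_iff (R := fun p => (pair_decode P p.2).2 = 0 \/
    exists v, theta (pair_decode P (pair_decode P p.2).1).1
       (pair_decode P (pair_decode P p.2).1).2
    = Some v /\ (pair_decode P p.2).2 = v.+1)).
    by move=> p; rewrite ext_graph2E.
  semidecidable.
  by apply: (sig1_subst (u := fun p : nat * nat * nat =>
    (pair_decode P (pair_decode P p.1.2).1, p.2)) st); computable.
- by computable.
- by move=> _; left; exists (0, 0).
exists (k 0); last exact: kE.
by apply: (comp_compose (u := fun x => (0, x)) ck); computable.
Qed.

Section GoedelNumberings.
Variables (phi : nat -> pfun1) (phi_goedel : goedel_numbering phi).

(** The union of the basis functions with index in [W phi i] is enumerated in the format of an
    extended graph. If these functions form a directed set, the union is the graph of their
    supremum, which is in [S1 A] because this graph is semidecidable; so the function given by (QGN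
    II) serves for (A II). *)
Lemma QGN2_A2 : QGN2 P A theta -> A2 D le al phi theta.
Proof.
have sW := sig1_W phi_goedel; have sa := sig1_alpha => Q.
pose U i x v := exists j, W phi i j /\ al j x = Some v.
have sU : sig1 (fun p : nat * nat * nat => U p.1.1 p.1.2 p.2).
  apply: sig1_ex; apply: sig1_and.
    by apply: (sig1_subst (u := fun p : nat * nat * nat * nat =>
      (p.1.1.1, p.2)) sW); computable.
  by apply: (sig1_subst (u := fun p : nat * nat * nat * nat =>
    (p.2, p.1.1.2, p.1.2)) sa); computable.
(* Values are shifted by one and 0 marks an empty step, so the enumeration is total even when the
   union is empty. *)
have [|||k ck kE] := @sig1_range nat _ (fun i n => (pair_decode P n).2 = 0 \/
  exists v, U i (pair_decode P n).1 v /\ (pair_decode P n).2 = v.+1) (fun=> P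
    (0, 0)).
- semidecidable.
  by apply: (sig1_subst (u := fun p : nat * nat * nat =>
    (p.1.1, (pair_decode P p.1.2).1, p.2)) sU); computable.
- by computable.
- by move=> i; left; rewrite pair_codeK.
have /Q[v mv vP] : R2 k by apply/comp_uncurry.
exists v => // i dW; have [s ls] := directed_sup dW; have [Ds sE] :=
  (is_lubP dW s).1 ls.
have {}sE x y : s x = Some y <-> U i x y.
  rewrite sE; split=> [[_ [j Wj <-] jx]|[j [Wj jx]]]; first by exists j.
  by exists (al j) => //; exists j.
suff <- : s = theta (v i) by [].
apply: vP.
  apply: S1_sig1 => //.
  apply: (sig1_iff (R := fun p => U i p.1 p.2)); first by move=> p; rewrite sE.
  by apply: (sig1_subst (u := fun p : nat * nat => (i, p.1, p.2)) sU);
    computable.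
rewrite kE; apply/seteqP; split=> n /=; rewrite ext_graph1E.
  by case=> [n0|[w [/sE ? ?]]]; [left|right; exists w].
by case=> [n0|[w [/sE ? ?]]]; [left|right; exists w].
Qed.

(** The s-m-n property gives an index of the set of all [j] whose finitely many values, shifted by
    one, are listed by [k i]. If [k i] lists the extended graph of [r], this set names exactly the
    members of [below r], and their supremum is [r]. *)
Lemma A2_QGN2 : A2 D le al phi theta -> QGN2 P A theta.
Proof.
move=> [d md dP] k mk; have ml := R1_alpha_len; have mv := R2_alpha_val.
have [|s ms sE] := sig1_smn phi_goedel (R := fun i j =>
  forall x, x < alpha_len j -> exists t, k i t = P (x, (alpha_val j x).+1)).
  by semidecidable.
exists (fun i => d (s i)); first exact: R1_comp.
move=> i r Sr kr; have Dr := S1_sub_S1hat Sr.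
have WE : al @` W phi (s i) = below r.
  have leE j : W phi (s i) j <-> le (al j) r.
    rewrite sE alpha_leP.
    have kE x y : (exists t, k i t = P (x, y.+1)) <-> r x = Some y.
      have -> : (exists t, k i t = P (x, y.+1)) <->
        ext_graph1 P r (P (x, y.+1)).
        by rewrite -kr; split=> -[t]; [exists t|move=> _ ht; exists t].
      rewrite ext_graph1E pair_codeK /=.
      by split=> [[//|[v [-> [->]]]//]|->]; right; exists y.
    by split=> h x /h/kE.
  apply/seteqP; split=> [_ [j /leE jr <-]|u []]; first by split;
    [exact: alpha_Anf|].
  by rewrite -alpha_range => -[j _ <-] /leE Wj; exists j.
have := dP (s i); rewrite WE => /(_ (below_directed Dr)).
exact: lub_unique (below_lub Dr).
Qed.

End GoedelNumberings.
End Numberings.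

(** * Computable operators and computable maps *)

Section Operators.
Variables (G : pfun1 -> pfun1) (G_S1hat : forall q, D q -> D (G q)).

Lemma computable_mapP : computable_map P D le al D le al G <->
  scott_continuous D le D le G /\
  sig1 (fun p : nat * nat => le (al p.2) (G (al p.1))).
Proof.
rewrite /computable_map ce_pairP.
have E p : way_below D le (al p.2) (G (al p.1)) <-> le (al p.2) (G (al p.1)).
  by apply: way_below_alphaP; exact/G_S1hat/alpha_S1hat.
by split=> -[cG sG]; split=> //; apply: sig1_iff sG => p; rewrite E.
Qed.

Lemma directed_image L : (forall q r, D q -> D r -> le q r -> le (G q) (G r)) ->
  directed D le L -> directed D le (G @` L).
Proof.
move=> Gmono [LD [u0 Lu0] Lub];
  split=> [_ [u /LD Du <-]||_ _ [u Lu <-] [v Lv <-]].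
- exact: G_S1hat.
- by exists (G u0), u0.
- have [w [Lw uw vw]] := Lub _ _ Lu Lv.
  by exists (G w); split; [exists w|apply: Gmono => //; exact: LD..].
Qed.

(** A value of [G q] depends on the finitely many points of [q] coded by some [a]. A larger argument
    still contains these points, which gives monotonicity, and a single member of a directed set
    contains them, which gives continuity. *)
Lemma operator_map :
  computable_operator P c A G -> computable_map P D le al D le al G.
Proof.
move=> [C /ceP sC CP]; apply/computable_mapP.
have GE q y z : D q -> G q y = Some z <-> exists a, C (P (P (y, z), a)) /\
    forall n, n \in seq_decode c a -> graph P q n.
  move=> Dq; have -> : G q y = Some z <-> graph P (G q) (P (y, z)).
    by rewrite graphE pair_codeK.
  rewrite CP //; split=> [[[y' z'] [a Ca aq] /(can_inj
    (pair_codeK P))[<- <-]]|[a [Ca aq]]].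
    by exists a.
  by exists (y, z) => //; exists a.
have Gmono q r : D q -> D r -> le q r -> le (G q) (G r).
  move=> Dq Dr qr; apply/sub_graphP => y z /(GE _ _ _ Dq)[a [Ca aq]].
  by apply/GE => //; exists a; split=> // n /aq/qr.
split.
  split=> // L s dL ls; have [Ds sE] := (is_lubP dL s).1 ls.
  have [LD _ _] := dL.
  apply/(is_lubP (directed_image Gmono dL)); split=> [|y z];
    first exact: G_S1hat.
  split=> [/(GE _ _ _ Ds)[a [Ca /(directed_seq dL ls)[u Lu au]]]|[_ [u Lu <-]]].
    by exists (G u); [exists u|apply/(GE _ _ _ (LD _ Lu)); exists a].
  have us : le u s by case: ls => _ + _; apply.
  by have /sub_graphP := Gmono _ _ (LD _ Lu) Ds us; apply.
apply: (sig1_le_alpha (u := fun p : nat * nat => p.2) (Q :=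
  fun p => G (al p.1))).
  by computable.
(* Membership in the coded sequence becomes a bounded quantifier over positions, the form that
   [sig1_all] handles. *)
apply: (sig1_iff (R := fun p : nat * nat * nat * nat => exists a,
  C (P (P (p.1.2, p.2), a)) /\ forall k, k < size (seq_decode c a) ->
  al p.1.1.1 (pair_decode P (nth 0 (seq_decode c a) k)).1 =
  Some (pair_decode P (nth 0 (seq_decode c a) k)).2)).
  move=> p; rewrite (GE _ _ _ (alpha_S1hat _)).
  split=> -[a [Ca aP]]; exists a; split=> //.
    by move=> n /(nthP 0)[k ka <-]; apply/graphE/aP.
  by move=> k ka; apply/graphE/aP/mem_nth.
have sa := sig1_alpha; semidecidable.
apply: (sig1_subst (u := fun p : nat * nat * nat * nat * nat * nat =>
  (p.1.1.1.1.1, (pair_decode P (nth 0 (seq_decode c p.1.2) p.2)).1,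
   (pair_decode P (nth 0 (seq_decode c p.1.2) p.2)).2)) sa); computable.
Qed.

(** The set [C] pairs a point of [G (al i)], certified by a basis function below it, with any
    sequence that contains the graph of [al i]. Monotonicity makes these rules sound, and continuity
    makes them complete. *)
Lemma map_operator :
  computable_map P D le al D le al G -> computable_operator P c A G.
Proof.
move=> /computable_mapP[[Gmono Glub] sG].
pose listed i a := forall x, x < alpha_len i -> exists k,
  k < size (seq_decode c a) /\ nth 0 (seq_decode c a) k = P (x, alpha_val i x).
have listedP i a : listed i a <-> forall n, graph P (al i) n ->
  n \in seq_decode c a.
  split=> [ia n /graphE|ia x xi].
    rewrite alphaE; case: ifP => // /ia[k [ka kE]] [nE].
    by rewrite -(pair_decodeK P n) [X in P X]surjective_pairing -nE -kE mem_nth.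
  have /ia/(nthP 0)[k ka kE] : graph P (al i) (P (x, alpha_val i x)).
    by apply/graphE; rewrite pair_codeK alphaE xi.
  by exists k.
pose C m := exists i, exists j, le (al j) (G (al i)) /\
  al j (pair_decode P (pair_decode P m).1).1 =
    Some (pair_decode P (pair_decode P m).1).2 /\
  listed i (pair_decode P m).2.
have sC : sig1 C.
  have ml := R1_alpha_len; have mv := R2_alpha_val; have sa := sig1_alpha.
  rewrite /C /listed; semidecidable.
    by apply: (sig1_subst (u := fun p : nat * nat * nat => (p.1.2, p.2)) sG);
      computable.
  by apply: (sig1_subst (u := fun p : nat * nat * nat =>
    (p.2, (pair_decode P (pair_decode P p.1.1).1).1,
     (pair_decode P (pair_decode P p.1.1).1).2)) sa); computable.
exists C; first exact/ceP.
have CE y z a : C (P (P (y, z), a)) <-> exists i j,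
    [/\ le (al j) (G (al i)), al j y = Some z & listed i a].
  rewrite /C pair_codeK /= pair_codeK /=.
  by split=> -[i [j]]; [case=> ? [? ?]|case=> ? ? ?]; exists i, j.
move=> r Dr; have dr := below_directed Dr.
(* By continuity [G r] is the union of the images of the initial segments below [r], so each of its
   values is already produced by one of them. *)
have /(is_lubP (directed_image Gmono dr))[_ GrE] := Glub _ _ dr (below_lub Dr).
apply/seteqP; split=> [_ [[y z] /= Gyz <-]|_ [[y z] /= [a /CE[i [j [ji jy ia]]]
  ar] <-]].
  exists (y, z) => //=.
  have /GrE[_ [u [Au ur] <-] uy] := Gyz.
  move: Au ur uy; rewrite -alpha_range => -[i _ <-] ir.
  rewrite (alpha_graphP _ _ (G_S1hat (alpha_S1hat i))) => -[j [ji jy]].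
  have [l lE] := Anf_graph_seq (alpha_Anf i).
  exists (seq_code c l); last by move=> n; rewrite seq_codeK => /lE/ir.
  apply/CE; exists i, j; split=> //; apply/listedP => n.
  by rewrite seq_codeK => /lE.
exists (y, z) => //=.
have ir : le (al i) r by move=> n /((listedP _ _).1 ia)/ar.
have /sub_graphP := Gmono _ _ (alpha_S1hat i) Dr ir; apply.
by move/sub_graphP: ji; apply.
Qed.

End Operators.

End CanonicalNumbering.
End Computability.

Theorem theorem9p7 (P : pairing) (c : seq_coding) (phi : nat -> pfun1)
    (phi_goedel : goedel_numbering phi)
    (A : set nat) (A_ce : ce A) (A_infinite : infinite_set A)
    (fA : nat -> nat) (fA_computable : R1 fA) (fA_range : range fA = A) :
  let D := S1hat A in
  let le := sub_graph P in
  let al := alpha P c fA in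
  (is_algebraic_domain D le /\ effectively_given D le P al (Anf A)) /\
  is_least D le nowhere /\
  compact_elements D le = Anf A /\
  computable_elements D le al = S1 A /\
  ((forall theta : nat -> pfun1, range theta = S1 A ->
      (QGN1 P theta <-> A1 D le P al theta) /\
      (QGN2 P A theta <-> A2 D le al phi theta)) /\
   (forall theta : nat -> pfun1,
      quasi_goedel P A theta <-> admissible D le P al phi theta)) /\
  (forall G : {fun D >-> D},
     computable_operator P c A G <-> computable_map P D le al D le al G).
Proof.
move=> D le al.
have compact := compactE P A_infinite.
have computable_S1 := computable_elementsE P c A_infinite fA_computable fA_range.
have numberings theta : range theta = S1 A ->
    (QGN1 P theta <-> A1 D le P al theta) /\
    (QGN2 P A theta <-> A2 D le al phi theta).
  move=> thetaS; split; last first.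
    by split; [exact: QGN2_A2|exact: A2_QGN2].
  by rewrite (QGN1P P c) (A1P P c A_infinite fA_computable fA_range thetaS).
split; [split|split; [|split; [|split; [|split; [split|]]]]].
- by split; [exact: S1hat_domain|rewrite compact; exact: Anf_basis].
- exact: alpha_effectively_given.
- exact: nowhere_least.
- exact: compact.
- exact: computable_S1.
- exact: numberings.
- move=> theta; split=> -[].
    move=> thetaS /(numberings _ thetaS).1 ? /(numberings _ thetaS).2 ?.
    by split=> //; rewrite computable_S1.
  rewrite computable_S1 => thetaS /(numberings _ thetaS).1 ? /(numberings _ thetaS).2 ?.
  by split.
- move=> G; have GD q : D q -> D (G q) by exact: funS.
  by split; [exact: operator_map|exact: map_operator].
Qed.
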